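(* For the tagged line segments in $\Omega$ the dimension vectors of the corresponding indecomposable $\Bbbk Q_D$-modules are as follows. For $1\le t\le n-1$, $$\mathbf{dim}\,F_D(\gamma_{-t}^{t,l})=\begin{cases}\sum_{i=n-t}^{n-1}\mathbf{dim}\,\overline S_i,& l=1,\\ \sum_{i=n-t}^{n-2}\mathbf{dim}\,\overline S_i+\mathbf{dim}\,\overline S_n,& l=-1;\end{cases}$$ and for $s<t$, $s\neq-t$, $$\mathbf{dim}\,F_D(\gamma_s^t)=\begin{cases}\sum_{i=n+s}^{n+t-1}\mathbf{dim}\,\overline S_i,& s<t<0,\\ \sum_{i=n+s}^{n}\mathbf{dim}\,\overline S_i+\sum_{i=n-t}^{n-2}\mathbf{dim}\,\overline S_i,& s<0<t,\\ \sum_{i=n-t}^{n-s-1}\mathbf{dim}\,\overline S_i,& 0<s<t.\end{cases}$$ Here $\mathbf{dim}$ denotes the dimension vector and $\overline S_i$ is the simple module supported at the vertex $i$ of $Q_D$.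
   Context: **Quivers.** $\Bbbk$ is an algebraically closed field of characteristic $\neq 2$ and $n\ge 4$. $Q_D$ is a quiver of type $\mathbb{D}_n$ with vertices $1,\dots,n$, an arrow $\beta_i$ between $i$ and $i+1$ for $1\le i\le n-2$, and an arrow $\beta_{n-1}$ between $n-2$ and $n$; the orientation is arbitrary except that $\beta_{n-2},\beta_{n-1}$ both point towards $n-2$ or both point away from $n-2$. $Q_A$ is the quiver of type $\mathbb{A}_{2n-3}$ with vertices $1,\dots,2n-3$ and arrows $\alpha_i$ between $i$ and $i+1$ such that for $1\le i\le n-2$: $\alpha_i$ is $i\to i+1$ iff $\beta_i$ is $i\to i+1$, and $\alpha_{2n-3-i}$ is $2n-2-i\to 2n-3-i$ iff $\alpha_i$ is $i\to i+1$. Modules are finite dimensional left modules, paths being composed from left to right: an arrow $\alpha:i\to j$ acts on $M$ as a linear map $e_jM\to e_iM$. $P_i=\Bbbk Q_Ae_i$, $\overline P_i=\Bbbk Q_De_i$ are the indecomposable projectives; $\tau$ is the Auslander–Reiten translation. Every indecomposable $\Bbbk Q_A$-module (resp. $\Bbbk Q_D$-module) is $\tau^{-k}P_i$ (resp. $\tau^{-k}\overline P_i$) for a unique vertex $i$ and unique $k\in\{0,\dots,n-2\}$. **Polygon.** For $0\le s\le 2n-3$ let $X_s=(x_s,y_s)$ on the unit circle with $y_s=-1+\frac{2s}{2n-3}$, where for $1\le s\le 2n-4$ one has $x_s>0$ if $\alpha_s$ is $s\to s+1$ and $x_s<0$ if $\alpha_s$ is $s\leftarrow s+1$. These are the vertices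 of a centrally symmetric convex $(2n-2)$-gon. Relabel $X_{s}$ as $Y_{s-n+1}$ if $y_s<0$ and as $Y_{s-n+2}$ if $y_s>0$; write $h'$ for the index with $X_{h'}=Y_h$. Then $Y_{-h}=-Y_h$. $P(Q_D)$ is this polygon with vertices $Y_{\pm1},\dots,Y_{\pm(n-1)}$ and a puncture at $O=(0,0)$. **Tagged line segments.** $\Omega=\{\gamma_s^t\mid -(n-1)\le s<t\le n-1,\ s\ne-t\}/\!\sim\ \cup\ \{\gamma_{-t}^{t,1},\gamma_{-t}^{t,-1}\mid 1\le t\le n-1\}$ (indices $s,t\neq0$), where $\gamma_s^t$ is the segment from $Y_s$ to $Y_t$, $\gamma_s^t\sim\gamma_{-t}^{-s}$, and $\gamma_{-t}^{t,\pm1}$ are two copies (tags $\pm1$) of the diameter from $Y_{-t}$ to $Y_t$. Let $[s,t]$ be the number of vertices on the boundary path counterclockwise from $Y_s$ to $Y_t$, endpoints included; $[s,t]+[-t,-s]=2n$. **The map $F_D:\Omega\to\{\text{indecomposable }\Bbbk Q_D\text{-modules}\}/\cong$.** For $0\le a<b\le 2n-3$, let $M(a+1,b)$ be the indecomposable $\Bbbk Q_A$-module with one-dimensional spaces exactly at the vertices $a+1,\dots,b$. For a class $\gamma_s^t$, $s\neq -t$, represented so that $2\le[s,t]\le n-1$: $M(s'+1,t')\cong\tau^{-k}P_i$ with $1\le i\le n-2$, and $F_D(\gamma_s^t)=\tau^{-k}\overline P_i$. For a diameter, $M((-t)'+1,t')\cong\tau^{-k}P_{n-1}$, and $F_D(\gamma_{-t}^{t,1})=\tau^{-k}\overline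 P_{n-1}$ if $k$ is even, $\tau^{-k}\overline P_n$ if $k$ is odd, while $F_D(\gamma_{-t}^{t,-1})=\tau^{-k}\overline P_{n}$ if $k$ is even, $\tau^{-k}\overline P_{n-1}$ if $k$ is odd. *)

(* Defs.v *)
From HB Require Import structures.
From mathcomp Require Import all_boot all_order all_algebra.
From mathcomp Require Import reals.

Set Implicit Arguments.
Unset Strict Implicit.
Unset Printing Implicit Defensive.

Import Order.TTheory GRing.Theory Num.Theory.
Local Open Scope ring_scope.

(* Throughout, paths are composed from left to right and modules over a path  *)
(* algebra A = kQ are left modules: an arrow a : i -> j acts as a linear map  *)
(* e_j M -> e_i M.                                                            *)

Record quiver := Quiver {
  vert : finType;
  arr : finType;
  src : arr -> vert;
  tgt : arr -> vert }.

Fixpoint walk (Q : quiver) (i : vert Q) (p : seq (arr Q)) (j : vert Q) : bool :=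
  if p is a :: p' then (src a == i) && walk (tgt a) p' j else i == j.

(* The basis of e_i (kQ) e_j.  The length bound loses nothing for the quivers *)
(* considered here: in an acyclic quiver a path has fewer arrows than there   *)
(* are vertices.                                                              *)
Definition qpath (Q : quiver) (i j : vert Q) :=
  {p : #|vert Q|.-bseq (arr Q) | walk i p j}.

Definition arrows (Q : quiver) (i j : vert Q) (w : qpath i j) : seq (arr Q) :=
  val (val w).

(* Finite dimensional modules, in coordinates: e_i M = 'rV_(dimv M i), and    *)
(* matrices act on row vectors from the right.                                *)
Record rep (k : fieldType) (Q : quiver) := Rep {
  dimv : vert Q -> nat;
  act : forall a : arr Q, 'M[k]_(dimv (tgt a), dimv (src a)) }.

Definition dim_vec (k : fieldType) (Q : quiver) (M : rep k Q) :
    {ffun vert Q -> nat} := [ffun i => dimv M i].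

Definition simple (k : fieldType) (Q : quiver) (i : vert Q) : rep k Q :=
  @Rep k Q (fun j => (j == i) : nat) (fun a => 0).

Section Morphisms.
Variables (k : fieldType) (Q : quiver).
Implicit Types M N : rep k Q.

Definition fam M N := forall i : vert Q, 'M[k]_(dimv M i, dimv N i).

Definition is_hom M N (f : fam M N) : Prop :=
  forall a : arr Q, act M a *m f (src a) = f (tgt a) *m act N a.

Definition fcomp M N L (f : fam M N) (g : fam N L) : fam M L :=
  fun i => f i *m g i.

Definition inj_fam M N (f : fam M N) : Prop := forall i, row_free (f i).
Definition surj_fam M N (f : fam M N) : Prop := forall i, row_full (f i).

Definition exact_at M N L (f : fam M N) (g : fam N L) : Prop :=
  forall i, (f i == kermx (g i))%MS.

Definition isom M N : Prop :=
  exists f : fam M N, [/\ is_hom f, inj_fam f & surj_fam f].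

Definition essential M N (f : fam M N) : Prop :=
  forall (L : rep k Q) (g : fam N L),
    is_hom g -> inj_fam (fcomp f g) -> inj_fam g.

End Morphisms.

Section Nakayama.
Variables (k : fieldType) (Q : quiver).

(* The direct sum of the projectives P_(p x) = A e_(p x), x < r.  At the      *)
(* vertex l it has the basis (x, u) with u a path l -> p x, and a : i -> j    *)
(* sends (x, u) to (x, a u).                                                  *)
Definition proj_basis r (p : 'I_r -> vert Q) (l : vert Q) : finType :=
  {x : 'I_r & qpath l (p x)}.

Definition projs r (p : 'I_r -> vert Q) : rep k Q :=
  @Rep k Q (fun l => #|proj_basis p l|)
    (fun a => \matrix_(u, v)
       let: existT x w := enum_val u : proj_basis p (tgt a) in
       let: existT x' w' := enum_val v : proj_basis p (src a) in
       ((x == x') && (arrows w' == a :: arrows w))%:R).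

(* The direct sum of the injectives I_(p x) = D(e_(p x) A), x < r.  At the    *)
(* vertex l it has the basis (x, u* ), dual to the paths u : p x -> l, and    *)
(* a : i -> j sends (x, u* ) to (x, v* ) if u = v a, and to 0 if u does not   *)
(* end with a.                                                                *)
Definition inj_basis r (p : 'I_r -> vert Q) (l : vert Q) : finType :=
  {x : 'I_r & qpath (p x) l}.

Definition injs r (p : 'I_r -> vert Q) : rep k Q :=
  @Rep k Q (fun l => #|inj_basis p l|)
    (fun a => \matrix_(u, v)
       let: existT x w := enum_val u : inj_basis p (tgt a) in
       let: existT x' w' := enum_val v : inj_basis p (src a) in
       ((x == x') && (rcons (arrows w') a == arrows w))%:R).

Definition proj (i : vert Q) : rep k Q := projs (fun _ : 'I_1 => i).

(* A family c x y of elements of e_(p x) A e_(q y), each given by its         *)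
(* coordinates on paths.  It encodes an arbitrary morphism between sums of    *)
(* projectives, since Hom(A e_i, A e_j) = e_i A e_j (right multiplication     *)
(* z |-> z c), and equally between sums of injectives, since                  *)
(* Hom(D(e_i A), D(e_j A)) = e_i A e_j (f |-> f(c _)); the inverse Nakayama   *)
(* functor sends inj_map c to proj_map c.                                     *)
Definition path_mx r s (p : 'I_r -> vert Q) (q : 'I_s -> vert Q) :=
  forall (x : 'I_r) (y : 'I_s), {ffun qpath (p x) (q y) -> k}.

Definition proj_map r s (p : 'I_r -> vert Q) (q : 'I_s -> vert Q)
    (c : path_mx p q) : fam (projs p) (projs q) :=
  fun l => \matrix_(u, v)
    let: existT x w := enum_val u : proj_basis p l in
    let: existT y w' := enum_val v : proj_basis q l in
    \sum_(z : qpath (p x) (q y) | arrows w ++ arrows z == arrows w') c x y z.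

Definition inj_map r s (p : 'I_r -> vert Q) (q : 'I_s -> vert Q)
    (c : path_mx p q) : fam (injs p) (injs q) :=
  fun l => \matrix_(u, v)
    let: existT x w := enum_val u : inj_basis p l in
    let: existT y w' := enum_val v : inj_basis q l in
    \sum_(z : qpath (p x) (q y) | arrows z ++ arrows w' == arrows w) c x y z.

(* N is isomorphic to tau^-1 M = Tr D M: it is the cokernel of the image      *)
(* under the inverse Nakayama functor of a minimal injective copresentation   *)
(* of M.  As kQ is hereditary, the latter is a minimal injective resolution   *)
(* 0 -> M -> I0 -> I1 -> 0, the minimality meaning that M -> I0 is an         *)
(* injective envelope.                                                        *)
Definition is_tau_inv (M N : rep k Q) : Prop :=
  exists (r s : nat) (p : 'I_r -> vert Q) (q : 'I_s -> vert Q)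
         (c : path_mx p q) (f : fam M (injs p)) (g : fam (projs q) N),
    [/\ is_hom f, inj_fam f & essential f] /\
    [/\ exact_at f (inj_map c) & surj_fam (inj_map c)] /\
    [/\ is_hom g, surj_fam g & exact_at (proj_map c) g].

(* N is isomorphic to tau^-m M. *)
Fixpoint is_tau_inv_iter (m : nat) (M N : rep k Q) : Prop :=
  if m is m'.+1 then exists2 L, is_tau_inv_iter m' M L & is_tau_inv L N
  else isom M N.

End Nakayama.

(* Vertices and arrows are numbered from 1: the vertex (arrow) with number i  *)
(* is the ordinal of value i - 1.                                             *)
Definition num m (v : 'I_m) : nat := v.+1.
Definition vx m (i : nat) : 'I_m.+1 := inord i.-1.

Section Quivers.
(* o i = true iff beta_i points away from the vertex i (i <= n - 2), resp.    *)
(* from the vertex n - 2 (i = n - 1).                                         *)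
Variables (n : nat) (o : nat -> bool).

Definition beta_low (i : nat) : nat := if (i <= n - 2)%N then i else (n - 2)%N.

Definition QD : quiver :=
  @Quiver 'I_(n - 1).+1 'I_(n - 1)
    (fun b => let i := num b in vx _ (if o i then beta_low i else i.+1))
    (fun b => let i := num b in vx _ (if o i then i.+1 else beta_low i)).

(* alpha_i is i -> i+1 (as opposed to i <- i+1). *)
Definition oA (i : nat) : bool :=
  if (i <= n - 2)%N then o i else ~~ o (2 * n - 3 - i)%N.

Definition QA : quiver :=
  @Quiver 'I_(2 * n - 4).+1 'I_(2 * n - 4)
    (fun a => let i := num a in vx _ (if oA i then i else i.+1))
    (fun a => let i := num a in vx _ (if oA i then i.+1 else i)).

(* The module M(a+1,b): one-dimensional exactly at a+1, ..., b, the arrows    *)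
(* between these vertices acting as the identity.                             *)
Definition interval (k : fieldType) (a b : nat) : rep k QA :=
  @Rep k QA (fun v => (a.+1 <= num v <= b)%N : nat) (fun _ => const_mx 1).

(* The sum of the dim S_i over the vertices i of Q_D with a <= i <= b. *)
Definition sum_dim_simple (k : fieldType) (a b : int) :
    {ffun vert QD -> nat} :=
  \sum_(v : vert QD | a <= (num v)%:Z <= b) dim_vec (simple k v).

End Quivers.

Section Polygon.
Variables (R : realType) (n : nat) (o : nat -> bool).

Definition ycoord (s : nat) : R := - 1 + (2 * s)%N%:R / (2 * n - 3)%N%:R.

(* For s = 0 and s = 2n - 3 the square root is 0. *)
Definition Xpt (s : nat) : R * R :=
  ((if oA n o s then 1 else - 1) * Num.sqrt (1 - ycoord s ^+ 2), ycoord s).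

(* h' , the index with X_(h') = Y_h *)
Definition prime_idx (h : int) : nat :=
  absz (if h < 0 then h + n%:Z - 1 else h + n%:Z - 2).

Definition Ypt (h : int) : R * R := Xpt (prime_idx h).

(* A, B, C form a counterclockwise triangle. *)
Definition ccw (A B C : R * R) : bool :=
  0 < (B.1 - A.1) * (C.2 - A.2) - (B.2 - A.2) * (C.1 - A.1).

(* The number [s,t]: as all vertices lie on the unit circle, Z is strictly    *)
(* inside the counterclockwise boundary path from Y_s to Y_t iff Y_s, Z, Y_t  *)
(* is a counterclockwise triangle.                                            *)
Definition bracket (s t : int) : nat :=
  #|[set z : 'I_(2 * n - 2) | [|| Xpt z == Ypt s, Xpt z == Ypt t
                                | ccw (Ypt s) (Xpt z) (Ypt t)]]|.

End Polygon.

(* Seg s t is gamma_s^t with s <> -t; Diam t true and Diam t false are        *)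
(* gamma_(-t)^(t,1) and gamma_(-t)^(t,-1).                                    *)
Inductive tagged_seg := Seg of int & int | Diam of int & bool.

Definition Omega (n : nat) (g : tagged_seg) : bool :=
  match g with
  | Seg s t => [&& 1 - n%:Z <= s, s < t, t <= n%:Z - 1, s != - t, s != 0 & t != 0]
  | Diam t _ => 1 <= t <= n%:Z - 1
  end.

Definition seg_equiv (g h : tagged_seg) : Prop :=
  g = h \/ exists s t, g = Seg s t /\ h = Seg (- t) (- s).

(* F_D R o g X: the Q_D-module X belongs to the isomorphism class F_D(g). *)
Definition F_D (R : realType) (k : fieldType) (n : nat) (o : nat -> bool)
    (g : tagged_seg) (X : rep k (QD n o)) : Prop :=
  match g with
  | Seg _ _ =>
      exists (s t : int) (m i : nat),
        [/\ seg_equiv g (Seg s t), (2 <= bracket R n o s t <= n - 1)%N,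
            (m <= n - 2)%N & (1 <= i <= n - 2)%N] /\
        is_tau_inv_iter m (proj k (vx _ i : vert (QA n o)))
          (interval n o k (prime_idx n s) (prime_idx n t)) /\
        is_tau_inv_iter m (proj k (vx _ i : vert (QD n o))) X
  | Diam t l =>
      exists m : nat,
        (m <= n - 2)%N /\
        is_tau_inv_iter m (proj k (vx _ (n - 1) : vert (QA n o)))
          (interval n o k (prime_idx n (- t)) (prime_idx n t)) /\
        is_tau_inv_iter m
          (proj k (vx _ (if l then if odd m then n else (n - 1)%N
                         else if odd m then (n - 1)%N else n)
                   : vert (QD n o))) X
  end.

(* Main.v *)
(** In Q_D and Q_A any two vertices are joined by at most one walk, so a morphism
    between sums of projectives (or of injectives) is a plain matrix, supported
    on the pairs of vertices joined by a walk.  For such a quiver, tau^-1 induces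
    a surjection from End M to End (tau^-1 M), so all iterates tau^-m P_i are
    bricks, and a brick M is either injective, and then tau^-1 M = 0, or
    dim (tau^-1 M) is the image of dim M under the inverse Coxeter transformation.

    Unfolding Q_D onto Q_A gives a linear map Theta on dimension vectors, which
    commutes with the inverse Coxeter transformations and sends dim P_i to
    dim P_i + dim P_(2n-2-i) for i <= n - 2, and to dim P_(n-1) for i = n - 1, n.
    Hence Theta (dim F_D(g)) is read off the interval module of the segment g.
    What Theta forgets is the difference of the coordinates at n - 1 and n,
    which changes sign under the inverse Coxeter transformation.  The dimension
    vectors of intervals for (s,t) and (-t,-s) are mirror images, so the choice
    of the representative (the condition on [s,t]) does not matter. *)

Require Import Defs.
From HB Require Import structures.
From mathcomp Require Import all_boot all_order all_algebra.
From mathcomp Require Import reals zify.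

Set Implicit Arguments.
Unset Strict Implicit.
Unset Printing Implicit Defensive.

Import Order.TTheory GRing.Theory Num.Theory.
Local Open Scope ring_scope.

(** * Quivers with unique walks *)

Lemma walk_cat (Q : quiver) (s1 s2 : seq (arr Q)) (i j : vert Q) :
  walk i (s1 ++ s2) j -> exists2 l, walk i s1 l & walk l s2 j.
Proof.
elim: s1 i => [|a s1 IH] i /=; first by exists i.
by case/andP=> -> /IH[l w1 w2]; exists l.
Qed.

Lemma cat_walk (Q : quiver) (s1 s2 : seq (arr Q)) (i l j : vert Q) :
  walk i s1 l -> walk l s2 j -> walk i (s1 ++ s2) j.
Proof.
elim: s1 i => [|a s1 IH] i /=; first by move/eqP->.
by case/andP=> -> w1 w2; apply: IH.
Qed.

Definition conn (Q : quiver) (i j : vert Q) : bool := (0 < #|{: qpath i j}|)%N.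

Definition unique_walks (Q : quiver) : Prop :=
  forall (i j : vert Q) (s s' : seq (arr Q)), walk i s j -> walk i s' j -> s = s'.

Section UniqueWalks.
Variables (Q : quiver) (Huniq : unique_walks Q).
Implicit Types (i j l : vert Q) (a b : arr Q).

(** A return to a vertex would cut out a nonempty closed walk, which uniqueness equates with the
    empty one. Hence the length bound built into [qpath] excludes no walk. *)
Lemma walk_visits_uniq i j (s : seq (arr Q)) :
  walk i s j -> uniq (i :: map (@tgt Q) s).
Proof.
elim: s i => [|a s IH] i // w0; have /andP[ai w] := w0.
rewrite cons_uniq [uniq (map _ _)]IH ?andbT {IH ai}//.
apply/negP => /mapP[b b_s ib].
case/splitPr: b_s w0 => s1 s2; rewrite -cat_rcons => w0.
have [l w1 _] := walk_cat w0.
suff w2 : walk i (rcons s1 b) i by have:= @Huniq i i _ [::] w2 (eqxx i); case: (s1).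
move: w1; rewrite -cats1 => /walk_cat[m w1 /= /andP[bm _]].
by apply: cat_walk w1 _; rewrite /= bm ib eqxx.
Qed.

Lemma connP i j : reflect (exists s, walk i s j) (conn i j).
Proof.
rewrite /conn; apply: (iffP card_gt0P) => [[w _] | [s w]].
  by exists (arrows w); apply: (valP w).
have s_le : (size s <= #|vert Q|)%N.
  have /card_uniqP/= sz := walk_visits_uniq w.
  by rewrite -(size_map (@tgt Q)) (leq_trans (leqnSn _)) // -sz max_card.
by exists (Sub (Bseq s_le) w).
Qed.

Lemma qpath_eq i j (w w' : qpath i j) : w = w'.
Proof. by do 2!apply: val_inj; apply: Huniq (valP w) (valP w'). Qed.

Lemma card_qpath i j : #|{: qpath i j}| = conn i j.
Proof.
rewrite /conn; case: posnP => // /card_gt0P[w _]; apply/eqP/fintype1P.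
by exists w => w'; apply: qpath_eq.
Qed.

Lemma conn_qpath i j (w : qpath i j) : conn i j.
Proof. by apply/connP; exists (arrows w); apply: (valP w). Qed.

Lemma conn_refl i : conn i i.
Proof. by apply/connP; exists [::] => /=. Qed.

Lemma conn_trans i j l : conn i j -> conn j l -> conn i l.
Proof.
by move=> /connP[s w] /connP[s' w']; apply/connP; exists (s ++ s'); apply: cat_walk w w'.
Qed.

Lemma conn_arr a : conn (src a) (tgt a).
Proof. by apply/connP; exists [:: a]; rewrite /= !eqxx. Qed.

Lemma conn_cycle a : ~~ conn (tgt a) (src a).
Proof.
apply/connP => -[s w]; suff w2: walk (src a) (a :: s) (src a).
  by have := @Huniq _ _ _ [::] w2 (eqxx _).
by rewrite /= eqxx.
Qed.

Lemma conn_first i l : conn i l -> i != l ->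
  exists a, [/\ src a = i, conn (tgt a) l &
    forall b, src b = i -> conn (tgt b) l -> b = a].
Proof.
move=> /connP[[|a s]] /=; first by move/eqP->; rewrite eqxx.
case/andP=> /eqP ai w _; exists a; split=> //; first by apply/connP; exists s.
move=> b bi /connP[s' w']; suff: b :: s' = a :: s by case.
by apply: (@Huniq i l) => /=; rewrite ?ai ?bi eqxx.
Qed.

Lemma conn_last i l : conn l i -> i != l ->
  exists a, [/\ tgt a = i, conn l (src a) &
    forall b, tgt b = i -> conn l (src b) -> b = a].
Proof.
move=> /connP[s]; elim/last_ind: s => [/eqP->|s a _]; first by rewrite eqxx.
rewrite -cats1 => w _; have [m w1 /= /andP[/eqP am /eqP ai]] := walk_cat w.
exists a; split=> //; first by apply/connP; exists s; rewrite am.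
move=> b bi /connP[s' w'].
have w'b : walk l (s' ++ [:: b]) i by apply: cat_walk w' _; rewrite /= bi !eqxx.
by have := Huniq w w'b; rewrite !cats1 => /rcons_inj[].
Qed.

Lemma conn_ind_src (l : vert Q) (P : vert Q -> Prop) :
    P l -> (forall a, conn (tgt a) l -> P (tgt a) -> P (src a)) ->
  forall i, conn i l -> P i.
Proof.
move=> Pl IH i /connP[s]; elim: s i => [|a s IHs] i /=; first by move/eqP->.
by case/andP=> /eqP<- w; apply: IH (IHs _ w); apply/connP; exists s.
Qed.

Lemma conn_ind_tgt (l : vert Q) (P : vert Q -> Prop) :
    P l -> (forall a, conn l (src a) -> P (src a) -> P (tgt a)) ->
  forall i, conn l i -> P i.
Proof.
move=> Pl IH i /connP[s]; elim/last_ind: s i => [|s a IHs] i /=.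
  by move/eqP<-.
rewrite -cats1 => /walk_cat[m w /= /andP[/eqP am /eqP <-]]; apply: IH.
  by rewrite am; apply/connP; exists s.
by apply: IHs; rewrite am.
Qed.

(** Passing from [src a] to [tgt a] strictly shrinks the set of reachable vertices, since the source
    itself is lost. *)
Lemma conn_rank_ind (P : vert Q -> Prop) :
    (forall i, (forall a, src a = i -> P (tgt a)) -> P i) -> forall i, P i.
Proof.
move=> IH i; have [N] := ubnP #|[set l | conn i l]|.
elim: N i => // N IHN i lt_iN; apply: IH => a ai; apply: IHN.
rewrite -ltnS (leq_trans _ lt_iN) // ltnS; apply: proper_card; apply/properP; split.
  apply/subsetP=> l; rewrite !inE; apply: conn_trans.
  by rewrite -ai conn_arr.
by exists i; rewrite !inE ?conn_refl // -ai conn_cycle.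
Qed.

(** For [i != l] at most one arrow leaving [i] starts a walk to [l]; for [i = l] none does. This
    recursion characterises [dim P_l]. *)
Lemma conn_sum_src i l :
  conn i l = ((i == l) + \sum_(a | src a == i) conn (tgt a) l)%N :> nat.
Proof.
have [->|il] := eqVneq i l.
  rewrite conn_refl big1 // => a /eqP ai.
  by apply/eqP; rewrite eqb0 -ai conn_cycle.
case: (boolP (conn i l)) => [/conn_first[]// a [ai al a_uniq] | nil].
  rewrite (bigD1 a) ?ai //= al big1 // => b /andP[/eqP bi ba].
  by apply/eqP; rewrite eqb0; apply: contra ba => /(a_uniq _ bi)->.
rewrite big1 // => a /eqP ai; apply/eqP; rewrite eqb0; apply: contra nil.
by apply: conn_trans; rewrite -ai conn_arr.
Qed.

Lemma conn_sum_tgt i l :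
  conn l i = ((i == l) + \sum_(a | tgt a == i) conn l (src a))%N :> nat.
Proof.
have [->|il] := eqVneq i l.
  rewrite conn_refl big1 // => a /eqP ai.
  by apply/eqP; rewrite eqb0 -ai conn_cycle.
case: (boolP (conn l i)) => [/conn_last[]// a [ai al a_uniq] | nil].
  rewrite (bigD1 a) ?ai //= al big1 // => b /andP[/eqP bi ba].
  by apply/eqP; rewrite eqb0; apply: contra ba => /(a_uniq _ bi)->.
rewrite big1 // => a /eqP ai; apply/eqP; rewrite eqb0; apply: contra nil.
by move/conn_trans; apply; rewrite -ai conn_arr.
Qed.

End UniqueWalks.
(** * Morphisms of representations *)

Section Families.
Variables (k : fieldType) (Q : quiver).
Implicit Types M N L : rep k Q.

(** The zero module counts as a brick, so that the property survives [tau^-1] of an injective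
    module. *)
Definition brick M : Prop :=
  forall h : fam M M, is_hom h -> exists c : k, forall i, h i = c%:M.

Definition fid M : fam M M := fun i => 1%:M.

Lemma fid_hom M : is_hom (@fid M).
Proof. by move=> a; rewrite mul1mx mulmx1. Qed.

Lemma fcomp_hom M N L (f : fam M N) (g : fam N L) :
  is_hom f -> is_hom g -> is_hom (fcomp f g).
Proof. by move=> hf hg a; rewrite /fcomp mulmxA hf -!mulmxA hg. Qed.

Lemma factor_through_mono M N L (f : fam M N) (u : fam L N) :
    is_hom f -> inj_fam f -> is_hom u -> (forall i, (u i <= f i)%MS) ->
  exists2 v : fam L M, is_hom v & forall i, v i *m f i = u i.
Proof.
move=> hf if_ hu uf; exists (fun i => u i *m pinvmx (f i)) => [a|i].
  apply: (row_free_inj (if_ (src a))).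
  by rewrite -mulmxA mulmxKpV // hu -[RHS]mulmxA hf [RHS]mulmxA mulmxKpV.
by rewrite mulmxKpV.
Qed.

(** A pseudo-inverse of [g] serves: the rows of [g i *m pinvmx (g i) - 1] lie in the kernel of
    [g i], hence in that of [u i]. *)
Lemma factor_through_epi M N L (g : fam M N) (u : fam M L) :
    is_hom g -> surj_fam g -> is_hom u -> (forall i, (kermx (g i) <= kermx (u i))%MS) ->
  exists2 v : fam N L, is_hom v & forall i, g i *m v i = u i.
Proof.
move=> hg sg hu gu.
have gK i : g i *m (pinvmx (g i) *m u i) = u i.
  apply/eqP; rewrite mulmxA -subr_eq0 -{2}[u i]mul1mx -mulmxBl -sub_kermx.
  apply: submx_trans (gu i); rewrite sub_kermx mulmxBl mul1mx -mulmxA mulVpmx //.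
  by rewrite mulmx1 subrr.
exists (fun i => pinvmx (g i) *m u i) => // a.
apply: (row_full_inj (sg (tgt a))).
by rewrite mulmxA -hg -mulmxA gK hu [RHS]mulmxA gK.
Qed.

Lemma isom_brick M N : brick M -> isom M N -> brick N.
Proof.
move=> bM [f [hf if_ sf]] h hh.
have [i|v hv vf] := factor_through_mono hf if_ (fcomp_hom hf hh).
  exact: submx_full.
have [c vc] := bM v hv; exists c => i; apply: (row_full_inj (sf i)).
by rewrite -[LHS]vf vc mul_scalar_mx mul_mx_scalar.
Qed.

Lemma isom_dimv M N i : isom M N -> Defs.dimv M i = Defs.dimv N i.
Proof. by move=> [f [_ /(_ i)/eqP <- /(_ i)/eqP]]. Qed.

End Families.

(** * Zero-one matrices that keep only the index of a basis element *)

Section Selection.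
Variables (k : fieldType) (r : nat) (B : 'I_r -> finType).

Definition sel : 'M[k]_(#|{: {x : 'I_r & B x}}|, r) :=
  \matrix_(u, x) (tag (enum_val u) == x)%:R.

Lemma mul_sel m (A : 'M[k]_(r, m)) u z : (sel *m A) u z = A (tag (enum_val u)) z.
Proof.
rewrite mxE (bigD1 (tag (enum_val u))) //= big1 => [|x xu]; rewrite mxE.
  by rewrite eqxx mul1r addr0.
by rewrite eq_sym (negPf xu) mul0r.
Qed.

Lemma mul_selT m (A : 'M[k]_(m, r)) z u : (A *m sel^T) z u = A z (tag (enum_val u)).
Proof.
rewrite mxE (bigD1 (tag (enum_val u))) //= big1 => [|x xu]; rewrite !mxE.
  by rewrite eqxx mulr1 addr0.
by rewrite eq_sym (negPf xu) mulr0.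
Qed.

Lemma selT_sel x y : (sel^T *m sel) x y = (x == y)%:R *+ #|B x|.
Proof.
rewrite mxE; under eq_bigr do rewrite !mxE.
rewrite -(big_enum_val (fun t => (tag t == x)%:R * (tag t == y)%:R)) /=.
under eq_bigl do rewrite -[_ \in _]/(true && true).
rewrite -(sig_big_dep xpredT (fun i => @predT (B i))
  (fun i _ => (i == x)%:R * (i == y)%:R)) /= (bigD1 x) //= sumr_const eqxx mul1r.
by rewrite big1 ?addr0 // => i /negPf ix; rewrite big1 // => _ _; rewrite ix mul0r.
Qed.

Hypothesis B1 : forall x (t t' : B x), t = t'.

Lemma sel_selT : sel *m sel^T = 1%:M.
Proof.
apply/matrixP=> u v; rewrite mul_sel !mxE eq_sym; congr (nat_of_bool _)%:R.
apply/eqP/eqP => [|->//] uv; apply: enum_val_inj.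
case: (enum_val u) (enum_val v) uv => x t [y t'] /= yx.
by rewrite -{y}yx in t' *; rewrite (B1 t t').
Qed.

(** [sel^T *m sel] is the diagonal projector onto the indices with nonempty fibre, and [A] has no
    other nonzero columns. *)
Lemma mul_sel_mask m (A : 'M[k]_(m, r)) :
  (forall z x, A z x != 0 -> (0 < #|B x|)%N) -> A *m sel^T *m sel = A.
Proof.
move=> HA; apply/matrixP=> z x; rewrite -mulmxA mxE (bigD1 x) //= selT_sel.
rewrite eqxx big1 => [|y /negPf yx]; last by rewrite selT_sel yx mul0rn mulr0.
have [->|/HA B0] := eqVneq (A z x) 0; first by rewrite mul0r addr0.
rewrite addr0; suff ->: #|B x| = 1%N by rewrite mulr1.
by case/card_gt0P: B0 => t _; apply/eqP/fintype1P; exists t => t'; apply: B1.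
Qed.

Lemma mul_selT_mask m (A : 'M[k]_(r, m)) :
  (forall z x, A x z != 0 -> (0 < #|B x|)%N) -> sel^T *m (sel *m A) = A.
Proof.
move=> HA; rewrite -[RHS]trmxK -[X in _ = X^T](@mul_sel_mask _ A^T).
  by rewrite !trmx_mul !trmxK.
by move=> z x; rewrite mxE; apply: HA.
Qed.

End Selection.
(** * Sums of projectives and of injectives *)

Section PathMatrices.
Variables (k : fieldType) (Q : quiver) (Huniq : unique_walks Q).
Implicit Types (i j l : vert Q) (a : arr Q).

(* [psel p l] and [isel p l] embed the basis of the module at [l] into the index
   set of the summands; this is injective since walks are unique. *)
Definition psel r (p : 'I_r -> vert Q) l : 'M[k]_(#|proj_basis p l|, r) :=
  @sel k r (fun x => qpath l (p x) : finType).

Definition isel r (p : 'I_r -> vert Q) l : 'M[k]_(#|inj_basis p l|, r) :=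
  @sel k r (fun x => qpath (p x) l : finType).

Definition supp r s (p : 'I_r -> vert Q) (q : 'I_s -> vert Q) (H : 'M[k]_(r, s)) : Prop :=
  forall x y, H x y != 0 -> conn (p x) (q y).

Definition projM r s (p : 'I_r -> vert Q) (q : 'I_s -> vert Q) (H : 'M[k]_(r, s)) :
    fam (projs k p) (projs k q) :=
  fun l => psel p l *m H *m (psel q l)^T.

Definition injM r s (p : 'I_r -> vert Q) (q : 'I_s -> vert Q) (H : 'M[k]_(r, s)) :
    fam (injs k p) (injs k q) :=
  fun l => isel p l *m H *m (isel q l)^T.

Lemma pselK r (p : 'I_r -> vert Q) l : psel p l *m (psel p l)^T = 1%:M.
Proof. by apply: sel_selT => x; apply: qpath_eq. Qed.

Lemma iselK r (p : 'I_r -> vert Q) l : isel p l *m (isel p l)^T = 1%:M.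
Proof. by apply: sel_selT => x; apply: qpath_eq. Qed.

Lemma psel_mask r (p : 'I_r -> vert Q) l m (A : 'M[k]_(m, r)) :
  (forall z x, A z x != 0 -> conn l (p x)) -> A *m (psel p l)^T *m psel p l = A.
Proof. by apply: mul_sel_mask => x; apply: qpath_eq. Qed.

Lemma isel_mask r (p : 'I_r -> vert Q) l m (A : 'M[k]_(r, m)) :
  (forall z x, A x z != 0 -> conn (p x) l) -> (isel p l)^T *m (isel p l *m A) = A.
Proof. by apply: mul_selT_mask => x; apply: qpath_eq. Qed.

Lemma mul_psel_conn r (p : 'I_r -> vert Q) l m (A : 'M[k]_(m, _)) z x :
  (A *m psel p l) z x != 0 -> conn l (p x).
Proof.
apply: contraR => nc; rewrite mxE big1 // => u _; rewrite mxE.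
case: eqP => [ux|_]; last by rewrite mulr0.
by case/negP: nc; rewrite -ux; apply: conn_qpath (tagged (enum_val u)).
Qed.

Lemma psel_mul_conn r (p : 'I_r -> vert Q) l m (A : 'M[k]_(r, m)) u z :
  (psel p l *m A) u z != 0 -> exists2 x, conn l (p x) & A x z != 0.
Proof.
rewrite mul_sel => Anz; exists (tag (enum_val u)) => //.
exact: conn_qpath (tagged (enum_val u)).
Qed.

Lemma mul_iselT_conn r (p : 'I_r -> vert Q) l m (A : 'M[k]_(m, r)) z u :
  (A *m (isel p l)^T) z u != 0 -> exists2 x, conn (p x) l & A z x != 0.
Proof.
rewrite mul_selT => Anz; exists (tag (enum_val u)) => //.
exact: conn_qpath (tagged (enum_val u)).
Qed.

Lemma iselT_src r (p : 'I_r -> vert Q) a :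
  (isel p (tgt a))^T *m (isel p (tgt a) *m (isel p (src a))^T) = (isel p (src a))^T.
Proof.
apply: isel_mask => u y; rewrite -[_^T]mul1mx => /mul_iselT_conn[x xi].
rewrite mxE; case: (y =P x) => [->|_]; last by rewrite eqxx.
by move=> _; apply: conn_trans xi (conn_arr Huniq a).
Qed.

Lemma eq_psel_mul r (p : 'I_r -> vert Q) l m (A B : 'M[k]_(r, m)) :
  (forall x, conn l (p x) -> row x A = row x B) -> psel p l *m A = psel p l *m B.
Proof.
move=> AB; apply/matrixP => u z; rewrite !mul_sel.
have /AB/rowP/(_ z) : conn l (p (tag (enum_val u))).
  exact: conn_qpath (tagged (enum_val u)).
by rewrite !mxE.
Qed.

Lemma eq_mul_isel r (p : 'I_r -> vert Q) l m (A B : 'M[k]_(m, r)) :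
  (forall x, conn (p x) l -> col x A = col x B) ->
  A *m (isel p l)^T = B *m (isel p l)^T.
Proof.
move=> AB; apply/matrixP => z u; rewrite !mul_selT.
have /AB/colP/(_ z) : conn (p (tag (enum_val u))) l.
  exact: conn_qpath (tagged (enum_val u)).
by rewrite !mxE.
Qed.

Lemma act_projs r (p : 'I_r -> vert Q) a :
  act (projs k p) a = psel p (tgt a) *m (psel p (src a))^T.
Proof.
apply/matrixP=> u v; rewrite mul_sel !mxE.
case: (enum_val u) (enum_val v) => x w [x' w'] /=; rewrite eq_sym.
congr (nat_of_bool _)%:R; case: eqVneq => //= x'x; case: x / x'x in w *.
apply/eqP/(Huniq (valP w')); rewrite /= eqxx; exact: valP w.
Qed.

Lemma act_injs r (p : 'I_r -> vert Q) a :
  act (injs k p) a = isel p (tgt a) *m (isel p (src a))^T.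
Proof.
apply/matrixP=> u v; rewrite mul_sel !mxE.
case: (enum_val u) (enum_val v) => x w [x' w'] /=; rewrite eq_sym.
congr (nat_of_bool _)%:R; case: eqVneq => //= x'x; case: x / x'x in w *.
apply/eqP/esym/(Huniq (valP w)); rewrite -cats1; apply: cat_walk (valP w') _.
by rewrite /= !eqxx.
Qed.

(** Each [e_(p x) A e_(q y)] has dimension at most one, so a morphism is one scalar per pair. The
    same [H] serves projectives and injectives: the inverse Nakayama functor keeps the matrix. *)
Lemma path_mxE r s (p : 'I_r -> vert Q) (q : 'I_s -> vert Q) (c : path_mx k p q) :
  exists2 H, supp p q H & forall l, proj_map c l = projM p q H l /\ Defs.inj_map c l = injM p q H l.
Proof.
exists (\matrix_(x, y) \sum_(z : qpath (p x) (q y)) c x y z) => [x y|l].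
  rewrite mxE; apply: contraR => nc; rewrite big1 // => z.
  by case/negP: nc; apply: conn_qpath z.
split; apply/matrixP => u v; rewrite mul_selT mul_sel !mxE.
  case: (enum_val u) (enum_val v) => x w [y w'] /=; apply: eq_bigl => z.
  by apply/eqP; apply: Huniq (cat_walk (valP w) (valP z)) (valP w').
case: (enum_val u) (enum_val v) => x w [y w'] /=; apply: eq_bigl => z.
by apply/eqP; apply: Huniq (cat_walk (valP z) (valP w')) (valP w).
Qed.

Section Maps.
Variables (r s t : nat) (p : 'I_r -> vert Q) (q : 'I_s -> vert Q)
  (b : 'I_t -> vert Q).
Implicit Types (H : 'M[k]_(r, s)) (K : 'M[k]_(s, t)).

Lemma supp_mul H K : supp p q H -> supp q b K -> supp p b (H *m K).
Proof.
move=> hH hK x z; rewrite mxE; apply: contraR => nc; rewrite big1 // => y _.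
apply/eqP; rewrite mulf_eq0; apply: contraR nc; rewrite negb_or => /andP[/hH + /hK].
exact: conn_trans.
Qed.

(** A walk from [l] to [p x] extends to [q y] wherever [H x y] is nonzero, so restricting to the
    basis at [l] loses nothing. Composition thus becomes the matrix product. *)
Lemma projM_psel H l : supp p q H -> projM p q H l *m psel q l = psel p l *m H.
Proof.
move=> hH; apply: psel_mask => u y /psel_mul_conn[x lx /hH].
exact: conn_trans.
Qed.

Lemma projM_comp H K l :
  supp p q H -> projM p q H l *m projM q b K l = projM p b (H *m K) l.
Proof. by move=> hH; rewrite [X in _ *m X]/projM !mulmxA projM_psel // /projM !mulmxA. Qed.

Lemma iselT_injM H l :
  supp p q H -> (isel p l)^T *m injM p q H l = H *m (isel q l)^T.
Proof.
move=> hH; rewrite /injM -mulmxA; apply: isel_mask => u x /mul_iselT_conn[y yl /hH].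
by move/conn_trans; apply.
Qed.

Lemma projM_hom H : supp p q H -> is_hom (projM p q H).
Proof.
move=> hH a; rewrite !act_projs [RHS]mulmxA projM_psel // -mulmxA /projM !mulmxA.
rewrite psel_mask // => u x.
rewrite -[psel p _]mul1mx => /mul_psel_conn.
by apply: conn_trans (conn_arr Huniq a).
Qed.

Lemma injM_hom H : supp p q H -> is_hom (injM p q H).
Proof.
move=> hH a; rewrite !act_injs -mulmxA iselT_injM // /injM -!mulmxA; congr (_ *m (_ *m _)).
by rewrite iselT_src.
Qed.

(** Row [x] of [H] is recovered at the vertex [p x], as the image of the trivial path. *)
Lemma projM_eq0 H : supp p q H -> (forall l, projM p q H l = 0) -> H = 0.
Proof.
move=> hH H0; apply/row_matrixP=> x; rewrite row0 rowE.
rewrite -[delta_mx 0 x](@psel_mask _ p (p x)) => [|z y].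
  by rewrite -mulmxA -projM_psel // H0 mul0mx mulmx0.
by rewrite mxE; case: (eqVneq y x) => [-> _|_]; rewrite ?andbF ?eqxx //; apply: conn_refl.
Qed.

Lemma injM_eq0 H : supp p q H -> (forall l, injM p q H l = 0) -> H = 0.
Proof.
move=> hH H0; apply/matrixP=> x y.
suff /colP/(_ x) : col y H = 0 by rewrite !mxE.
rewrite colE.
rewrite -[delta_mx y 0](@isel_mask _ q (q y)) => [|z x'].
  by rewrite mulmxA -iselT_injM // H0 mulmx0 mul0mx.
by rewrite mxE; case: (eqVneq x' y) => [-> _|_]; rewrite ?eqxx //; apply: conn_refl.
Qed.

End Maps.

Lemma injM_comp r s t (p : 'I_r -> vert Q) (q : 'I_s -> vert Q) (b : 'I_t -> vert Q) H K l :
  supp q b K -> injM p q H l *m injM q b K l = injM p b (H *m K) l.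
Proof. by move=> hK; rewrite [X in X *m _]/injM -[LHS]mulmxA iselT_injM // /injM !mulmxA. Qed.

Lemma projM1 r (p : 'I_r -> vert Q) c l : projM p p c%:M l = c%:M.
Proof. by rewrite /projM mul_mx_scalar -scalemxAl pselK scalemx1. Qed.

Lemma injM1 r (p : 'I_r -> vert Q) c l : injM p p c%:M l = c%:M.
Proof. by rewrite /injM mul_mx_scalar -scalemxAl iselK scalemx1. Qed.

Lemma supp_scalar r (p : 'I_r -> vert Q) c : supp p p c%:M.
Proof.
move=> x y; rewrite mxE; case: (eqVneq x y) => [-> _|_]; first exact: conn_refl.
by rewrite mulr0n eqxx.
Qed.

Lemma supp_sub r s (p : 'I_r -> vert Q) (q : 'I_s -> vert Q) H K :
  supp p q H -> supp p q K -> supp p q (H - K).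
Proof.
move=> hH hK x y; rewrite !mxE; have [->|/hH//] := eqVneq (H x y) 0.
by rewrite sub0r oppr_eq0 => /hK.
Qed.

Lemma supp_scale r s (p : 'I_r -> vert Q) (q : 'I_s -> vert Q) c H :
  supp p q H -> supp p q (c *: H).
Proof. by move=> hH x y; rewrite !mxE mulf_eq0 negb_or => /andP[_ /hH]. Qed.

Lemma projMB r s (p : 'I_r -> vert Q) (q : 'I_s -> vert Q) H K l :
  projM p q (H - K) l = projM p q H l - projM p q K l.
Proof. by rewrite /projM mulmxBr mulmxBl. Qed.

Lemma projMD r s (p : 'I_r -> vert Q) (q : 'I_s -> vert Q) H K l :
  projM p q (H + K) l = projM p q H l + projM p q K l.
Proof. by rewrite /projM mulmxDr mulmxDl. Qed.

Lemma injMB r s (p : 'I_r -> vert Q) (q : 'I_s -> vert Q) H K l :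
  injM p q (H - K) l = injM p q H l - injM p q K l.
Proof. by rewrite /injM mulmxBr mulmxBl. Qed.

(** A morphism out of [projs p] is determined by the images of the trivial paths at the [p x]. Row
    [x] of [H] is a preimage of such an image under [g], and the equality propagates back along the
    walks into [p x]. *)
Lemma projs_lift r s (p : 'I_r -> vert Q) (q : 'I_s -> vert Q) (N : rep k Q)
    (u : fam (projs k p) N) (g : fam (projs k q) N) :
    is_hom u -> is_hom g -> (forall l, (u l <= g l)%MS) ->
  exists2 H, supp p q H & forall l, projM p q H l *m g l = u l.
Proof.
move=> hu hg ug.
pose H := \matrix_x (row x ((psel p (p x))^T *m u (p x)) *m pinvmx (g (p x)) *m psel q (p x)).
have hH : supp p q H by move=> x y; rewrite mxE => /mul_psel_conn.
exists H => // l.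
rewrite -[LHS]mul1mx -[RHS]mul1mx -pselK -[LHS]mulmxA -[RHS]mulmxA.
apply: eq_psel_mul => x; move: l.
(* A path starting with [a] is its tail acted on by [a]. *)
have step (v : fam (projs k p) N) a : is_hom v -> conn (tgt a) (p x) ->
    row x ((psel p (src a))^T *m v (src a)) =
    row x ((psel p (tgt a))^T *m v (tgt a)) *m act N a.
  move=> hv ax; rewrite !rowE -!mulmxA -hv act_projs !mulmxA psel_mask // => z y.
  by rewrite mxE; case: (eqVneq y x) => [->|_]; rewrite ?andbF ?eqxx.
have hv := fcomp_hom (projM_hom hH) hg.
apply: (@conn_ind_src _ Huniq (p x)) => [|a ax IH].
  rewrite /projM !mulmxA !rowE !mulmxA psel_mask => [|z y].
    rewrite -rowE rowK -[_ *m psel q _ *m _]mulmxA pselK mulmx1 mulmxKpV.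
      by rewrite rowE !mulmxA.
    by rewrite (submx_trans _ (ug _)) // row_mul submxMl.
  by rewrite mxE; case: (eqVneq y x) => [-> _|_]; rewrite ?andbF ?eqxx //; apply: conn_refl.
by have := step _ a hv ax; rewrite /fcomp IH => ->; rewrite -step.
Qed.

(** [T l] is [W l] in the indices of the summands. Its column [y] is the same at all vertices [l]
    reached from [q y], so the value at [q y] determines it. *)
Lemma injs_hom_injM r s (p : 'I_r -> vert Q) (q : 'I_s -> vert Q)
    (W : fam (injs k p) (injs k q)) :
  is_hom W -> exists2 H, supp p q H & forall l, W l = injM p q H l.
Proof.
move=> hW; pose T l := (isel p l)^T *m W l *m isel q l.
exists (\matrix_(x, y) T (q y) x y) => [x y|l].
  rewrite mxE /T -mulmxA; apply: contraR => nc.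
  rewrite mxE big1 // => u _; rewrite !mxE.
  case: eqP => [ux|_]; last by rewrite mul0r.
  by case/negP: nc; rewrite -ux; apply: conn_qpath (tagged (enum_val u)).
rewrite -[LHS]mulmx1 -iselK -[LHS]mul1mx -[in LHS]iselK /injM -!mulmxA; congr (_ *m _).
rewrite !mulmxA; apply: eq_mul_isel => y yl.
suff -> : col y (T l) = col y (T (q y)) by apply/colP => x; rewrite !mxE.
move: l yl; apply: (@conn_ind_tgt _ Huniq (q y)) => // a ya <-.
have d_mask : (isel q (src a))^T *m (isel q (src a) *m delta_mx y 0) = delta_mx y 0 :> 'M[k]_(_, 1).
  by apply: isel_mask => z x; rewrite mxE; case: (eqVneq x y) => [->|_]; rewrite ?eqxx.
have := hW a; rewrite !act_injs => hWa.
rewrite !colE /T -{1}d_mask.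
transitivity ((isel p (tgt a))^T *m (W (tgt a) *m (isel q (tgt a) *m (isel q (src a))^T))
  *m isel q (src a) *m (delta_mx y 0 : 'cV_s)); first by rewrite !mulmxA.
by rewrite -hWa !mulmxA -[_ *m _ *m (isel p (src a))^T]mulmxA iselT_src.
Qed.

End PathMatrices.
(** * The inverse Coxeter transformation and [tau^-1] *)

Section Coxeter.
Variable Q : quiver.
Implicit Types (d e : vert Q -> int) (x l : vert Q).

Definition out_sum d x : int := \sum_(a | src a == x) d (tgt a).
Definition in_sum d x : int := \sum_(a | tgt a == x) d (src a).

(* [e] is the image of [d] under the inverse Coxeter transformation, which
   sends [dim I_l] to [- dim P_l]. *)
Definition cox d e : Prop := forall x, e x + d x = out_sum e x + in_sum d x.

Definition dimz (k : fieldType) (M : rep k Q) x : int := (Defs.dimv M x)%:Z.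

Lemma eq_cox d d' e e' : d =1 d' -> e =1 e' -> cox d e -> cox d' e'.
Proof.
move=> dd' ee' de x; rewrite -dd' -ee' de; congr (_ + _).
  by apply: eq_bigr => a _; rewrite ee'.
by apply: eq_bigr => a _; rewrite dd'.
Qed.

Lemma cox_add d d' e e' :
  cox d e -> cox d' e' -> cox (fun x => d x + d' x) (fun x => e x + e' x).
Proof.
by move=> de de' x; rewrite /out_sum /in_sum !big_split addrACA de de' [RHS]addrACA.
Qed.

Lemma cox_opp d e : cox d e -> cox (fun x => - d x) (fun x => - e x).
Proof. by move=> de x; rewrite /out_sum /in_sum !sumrN -!opprD de. Qed.

Lemma cox_big r (d e : 'I_r -> vert Q -> int) :
    (forall y, cox (d y) (e y)) ->
  cox (fun x => \sum_y d y x) (fun x => \sum_y e y x).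
Proof.
move=> de x; rewrite /out_sum /in_sum exchange_big [X in _ = _ + X]exchange_big -!big_split /=.
by apply: eq_bigr => y _; apply: de.
Qed.

Hypothesis Huniq : unique_walks Q.

(** The system is triangular: the value at [x] involves only the targets of arrows leaving [x]. *)
Lemma out_eq_unique (c d e : vert Q -> int) :
    (forall x, d x = c x + out_sum d x) -> (forall x, e x = c x + out_sum e x) ->
  d =1 e.
Proof.
move=> dE eE; apply: (conn_rank_ind Huniq) => x IH; rewrite dE eE; congr (_ + _).
by apply: eq_bigr => a /eqP/IH.
Qed.

Lemma cox_unique d e e' : cox d e -> cox d e' -> e =1 e'.
Proof.
move=> de de'; apply: (@out_eq_unique (fun x => in_sum d x - d x)) => x.
  by rewrite addrAC [in_sum d x + _]addrC -de addrK.
by rewrite addrAC [in_sum d x + _]addrC -de' addrK.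
Qed.

Lemma conn_out_sum l x :
  (conn x l)%:Z = (x == l)%:Z + out_sum (fun x => (conn x l)%:Z) x.
Proof.
rewrite conn_sum_src // PoszD; congr (_ + _).
by rewrite -natz natr_sum; apply: eq_bigr => a _; rewrite natz.
Qed.

Lemma conn_in_sum l x :
  (conn l x)%:Z = (x == l)%:Z + in_sum (fun x => (conn l x)%:Z) x.
Proof.
rewrite conn_sum_tgt // PoszD; congr (_ + _).
by rewrite -natz natr_sum; apply: eq_bigr => a _; rewrite natz.
Qed.

(** The recursions for [dim I_l] and [dim P_l] have the same inhomogeneous term, the unit at [l],
    and the two copies cancel. *)
Lemma cox_inj_proj l : cox (fun x => (conn l x)%:Z) (fun x => - (conn x l)%:Z).
Proof.
move=> x; rewrite conn_out_sum conn_in_sum opprD addrACA addNr add0r.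
by rewrite /out_sum sumrN.
Qed.

Variable k : fieldType.

Lemma card_tag_conn r (c : 'I_r -> bool) (B : 'I_r -> finType) :
  (forall y, #|B y| = c y) -> #|{: {y : 'I_r & B y}}|%:Z = \sum_y (c y)%:Z.
Proof.
move=> Bc; rewrite card_tagged sumnE big_map -natz natr_sum big_enum.
by apply: eq_bigr => x _; rewrite natz Bc.
Qed.

Lemma dimz_projs r (p : 'I_r -> vert Q) x :
  dimz (projs k p) x = \sum_y (conn x (p y))%:Z.
Proof. by apply: card_tag_conn => y; apply: card_qpath. Qed.

Lemma dimz_injs r (p : 'I_r -> vert Q) x :
  dimz (injs k p) x = \sum_y (conn (p y) x)%:Z.
Proof. by apply: card_tag_conn => y; apply: card_qpath. Qed.

Lemma cox_injs_projs r (p : 'I_r -> vert Q) :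
  cox (dimz (injs k p)) (fun x => - dimz (projs k p) x).
Proof.
apply: eq_cox (cox_big (fun y => cox_inj_proj (p y))) => x.
  by rewrite dimz_injs.
by rewrite dimz_projs sumrN.
Qed.

End Coxeter.

(** * Bricks and their dimension vectors under [tau^-1] *)

Section TauInverse.
Variables (k : fieldType) (Q : quiver) (Huniq : unique_walks Q).

Lemma brick_projs (i : vert Q) : brick (proj k i).
Proof.
move=> h hh; have [l|H hH Hh] := projs_lift Huniq hh (fid_hom (proj k i)).
  by rewrite submx1.
exists (H 0 0) => l; by rewrite -Hh mulmx1 {1}[H]mx11_scalar projM1.
Qed.

Section Presentation.
Variables (M N : rep k Q) (r s : nat) (p : 'I_r -> vert Q) (q : 'I_s -> vert Q).
Variables (C : 'M[k]_(r, s)) (f : fam M (injs k p)) (g : fam (projs k q) N).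
Hypotheses (hC : supp p q C) (brickM : brick M).
Hypotheses (hf : is_hom f) (if_ : inj_fam f) (ef : exact_at f (injM p q C))
           (sC : surj_fam (injM p q C)).
Hypotheses (hg : is_hom g) (sg : surj_fam g) (eg : exact_at (projM p q C) g).

Lemma injM_cancel (K : 'M[k]_s) : supp q q K -> C *m K = 0 -> K = 0.
Proof.
move=> hK CK; apply: (injM_eq0 Huniq hK) => l.
apply: (row_full_inj (sC l)); rewrite injM_comp // CK mulmx0.
by rewrite /injM mulmx0 mul0mx.
Qed.

(* A morphism between the two-term complexes of injectives acts on M by a
   scalar, hence is homotopic to that scalar. *)
Lemma brick_homotopy (H0 : 'M[k]_r) (H1 : 'M[k]_s) :
    supp p p H0 -> supp q q H1 -> H0 *m C = C *m H1 ->
  exists c (W : 'M[k]_(s, r)), supp q p W /\ H0 = c%:M + C *m W.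
Proof.
move=> h0 h1 H01.
have fC l : f l *m injM p q C l = 0.
  by apply/eqP; rewrite -sub_kermx; case/andP: (ef l).
have [l|v hv vf] := factor_through_mono hf if_ (fcomp_hom hf (injM_hom Huniq h0)).
  have /andP[_ /(submx_trans _)] := ef l; apply.
  rewrite sub_kermx /fcomp -mulmxA injM_comp // H01 -(@injM_comp _ _ Huniq _ _ _ p q) // mulmxA fC.
  by rewrite mul0mx.
have [c vc] := brickM hv.
have hZ : supp p p (H0 - c%:M) by apply: supp_sub h0 (@supp_scalar _ _ Huniq _ _ _).
have [l|W hW CW] := factor_through_epi (injM_hom Huniq hC) sC (injM_hom Huniq hZ).
  have /andP[_ /submx_trans] := ef l; apply.
  by rewrite sub_kermx injMB injM1 // mulmxBr -[f l *m _](vf l) vc mul_scalar_mx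
    mul_mx_scalar subrr.
have [K hK WK] := injs_hom_injM Huniq hW.
exists c, K; split=> //; apply/eqP; rewrite -subr_eq0 opprD addrA; apply/eqP.
apply: (injM_eq0 Huniq (supp_sub hZ (supp_mul Huniq hC hK))) => l.
by rewrite injMB -CW WK injM_comp // subrr.
Qed.

(** Lift [h] to a pair [H0], [H1] on the projective presentation. The same matrices act on the
    injective copresentation, where [brick_homotopy] gives [H0 = c + C W]. Cancelling [C] gives
    [H1 = c + W C], and [W C] dies on composing with [g]. *)
Lemma presentation_brick : brick N.
Proof.
move=> h hh.
have [l|H1 h1 H1g] := projs_lift Huniq (fcomp_hom hg hh) hg.
  exact: submx_full.
have hCp := projM_hom Huniq hC.
have Cg l : projM p q C l *m g l = 0.
  by apply/eqP; rewrite -sub_kermx; case/andP: (eg l).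
have [l|H0 h0 H0C] := projs_lift Huniq (fcomp_hom hCp (projM_hom Huniq h1)) hCp.
  have /andP[_ /(submx_trans _)] := eg l; apply.
  by rewrite sub_kermx /fcomp -mulmxA H1g mulmxA Cg mul0mx.
have HC : H0 *m C = C *m H1.
  apply/eqP; rewrite -subr_eq0; apply/eqP.
  apply: (projM_eq0 Huniq (supp_sub (supp_mul Huniq h0 hC) (supp_mul Huniq hC h1))) => l.
  by rewrite projMB -(projM_comp Huniq q C l h0) -(projM_comp Huniq q H1 l hC) H0C subrr.
have [c [W [hW H0E]]] := brick_homotopy h0 h1 HC.
have H1E : H1 = c%:M + W *m C.
  apply/eqP; rewrite -subr_eq0 opprD addrA; apply/eqP.
  apply: injM_cancel.
    by apply: supp_sub (supp_mul Huniq hW hC); apply: supp_sub h1 (@supp_scalar _ _ Huniq _ _ _).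
  rewrite mulmxBr mulmxBr -HC H0E mulmxDl mul_scalar_mx mul_mx_scalar mulmxA.
  by rewrite addrAC addrK subrr.
exists c => l; apply: (row_full_inj (sg l)).
rewrite -[LHS]H1g H1E projMD projM1 // -(projM_comp Huniq q C l hW).
by rewrite mulmxDl -mulmxA Cg mulmx0 addr0 mul_scalar_mx mul_mx_scalar.
Qed.

(* A kernel element of minimal support has a nonzero coordinate on a trivial
   path: otherwise split it according to the first arrow. *)
Lemma kernel_unit_coord l (v : 'rV[k]_r) :
    v != 0 -> v *m C = 0 -> (forall z y, v z y != 0 -> conn l (p y)) ->
  exists (w : 'rV[k]_r) y,
    [/\ w 0 y != 0, w *m C = 0 & forall z y', w z y' != 0 -> conn (p y) (p y')].
Proof.
move: l v; apply: (conn_rank_ind Huniq) => l IH v v0 vC vl.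
have [/existsP[y /andP[/eqP yl vy]]|] := boolP [exists y, (p y == l) && (v 0 y != 0)].
  by exists v, y; split=> // z y'; rewrite yl; apply: vl.
rewrite negb_exists => /forallP nl.
have [y vy] : exists y, v 0 y != 0.
  by case/rV0Pn: v0 => y; exists y.
have ly : l != p y by have := nl y; rewrite vy andbT eq_sym.
have [a [al ay a_uniq]] := conn_first Huniq (vl _ _ vy) ly.
(* [w] keeps the coordinates of [v] whose walk from [l] starts with [a]. *)
pose w : 'rV[k]_r := \row_y' (if conn (tgt a) (p y') then v 0 y' else 0).
apply: (IH a al w).
- by apply/rV0Pn; exists y; rewrite mxE ay.
- apply/rowP => z; rewrite mxE [RHS]mxE.
  have [az|naz] := boolP (conn (tgt a) (q z)).
    have /rowP/(_ z) := vC; rewrite mxE [RHS]mxE => vC0.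
    rewrite -[RHS]vC0; apply: eq_bigr => y' _; rewrite mxE; case: ifPn => // nay.
    have [->|vy'] := eqVneq (v 0 y') 0; first by rewrite mul0r.
    have [->|Cy] := eqVneq (C y' z) 0; first by rewrite !mulr0.
    have ly' : l != p y' by have := nl y'; rewrite vy' andbT eq_sym.
    have [b [bl by' _]] := conn_first Huniq (vl _ _ vy') ly'.
    have bz := conn_trans Huniq by' (hC Cy).
    have lz : l != q z.
      by apply: contraTneq az => <-; rewrite -al conn_cycle.
    (* The walks from [l] to [q z] through [p y'] and through [a] coincide, so their first arrows
       agree. *)
    have [b' [_ _ b'_uniq]] := conn_first Huniq (conn_trans Huniq (vl _ _ vy') (hC Cy)) lz.
    by case/negP: nay; rewrite (b'_uniq a al az) -(b'_uniq b bl bz).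
  rewrite big1 // => y' _; rewrite mxE; case: ifP => [ay'|_]; last by rewrite mul0r.
  have [->|Cy] := eqVneq (C y' z) 0; first by rewrite mulr0.
  by case/negP: naz; apply: conn_trans ay' (hC Cy).
by move=> z y'; rewrite mxE; case: ifP => // _; rewrite eqxx.
Qed.

(** If the map of projectives is not injective, a kernel vector [w] with [w 0 y] nonzero at a
    trivial path gives an endomorphism [E] of the complex that is zero on the second term. It is
    homotopic to a scalar [c], and [E E = w 0 y E] forces [c = w 0 y]. Then [W C = - c], so the map
    is a split epimorphism. *)
Lemma presentation_dichotomy :
  (forall l, row_free (projM p q C l)) \/
  (forall l, row_full (projM p q C l)).
Proof.
have [/forallP|] := boolP [forall l, row_free (projM p q C l)]; first by left.
rewrite negb_forall => /existsP[l]; rewrite -kermx_eq0 => /rowV0Pn[v0 v0C nz].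
right.
have v0C0 : v0 *m projM p q C l = 0 by apply/eqP; rewrite -sub_kermx.
have [|||w [y [wy wC ws]]] := @kernel_unit_coord l (v0 *m psel k p l).
- apply: contra nz => /eqP/(congr1 (fun X => X *m (psel k p l)^T)).
  by rewrite -mulmxA pselK // mulmx1 mul0mx => ->.
- by rewrite -mulmxA -(projM_psel Huniq l hC) mulmxA v0C0 mul0mx.
- by move=> z y; apply: mul_psel_conn.
pose E := delta_mx y 0 *m w.
have hE : supp p p E.
  move=> x x'; rewrite mxE big_ord1 mxE eqxx andbT; have [->|_] := eqVneq x y.
    by rewrite mul1r => /ws.
  by rewrite mul0r eqxx.
have EC : E *m C = 0 by rewrite -mulmxA wC mulmx0.
have [||c [W [hW EE]]] := @brick_homotopy E 0 hE.
- by move=> x z; rewrite mxE eqxx.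
- by rewrite EC mulmx0.
have E2 : E *m E = w 0 y *: E.
  rewrite mulmxA -[E *m delta_mx y 0]mulmxA -colE [col y w]mx11_scalar mxE.
  by rewrite mul_mx_scalar scalemxAl.
have c_wy : c = w 0 y.
  have : w 0 y *: E = c *: E.
    by rewrite -E2 {2}EE mulmxDr mulmxA EC mul0mx addr0 mul_mx_scalar.
  move/matrixP/(_ y y); rewrite !mxE big_ord1 !mxE !eqxx mul1r.
  by move/(mulIf wy).
have WC : c%:M + W *m C = 0.
  apply/injM_cancel.
    rewrite -[W *m C]opprK -(scaleN1r (W *m C)).
    exact: supp_sub (@supp_scalar _ _ Huniq _ _ _) (supp_scale (supp_mul Huniq hW hC)).
  by rewrite mulmxDr mulmxA mul_mx_scalar -mul_scalar_mx -mulmxDl -EE.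
move=> l'; apply/row_fullP; exists (projM q p (- c^-1 *: W) l').
rewrite projM_comp //; last exact: supp_scale.
rewrite -scalemxAl -[W *m C](addKr c%:M) WC addr0 scalerN scaleNr opprK.
by rewrite scale_scalar_mx mulVf ?projM1 // c_wy.
Qed.

Lemma presentation_dim l :
  Defs.dimv N l = (Defs.dimv (projs k q) l - \rank (projM p q C l))%N.
Proof.
rewrite (eqmxP (eg l)) mxrank_ker subKn ?rank_leq_row //.
by apply/esym/eqP/(sg l).
Qed.

End Presentation.

(** The inverse Coxeter transformation takes [dim I0 - dim I1] to [dim P1 - dim P0]. If [P0 -> P1]
    is injective this is [dim N]. Otherwise [P0 -> P1] is onto, [N] vanishes, and the vector is
    minus the dimension of a nonzero kernel; this sign later excludes the case. *)
Lemma tau_inv_brick_dim (M N : rep k Q) : brick M -> is_tau_inv M N ->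
  brick N /\ (cox (dimz M) (dimz N) \/
    (forall l, Defs.dimv N l = 0%N) /\
    exists e, [/\ cox (dimz M) e, forall l, e l <= 0 & exists l, e l < 0]).
Proof.
move=> bM [r [s [p [q [c [f [g [[hf if_ _] [[ef sc] [hg sg eg]]]]]]]]]].
have [C hC cE] := path_mxE Huniq c.
have {}ef : exact_at f (injM p q C) by move=> l; rewrite -(cE l).2.
have {}sc : surj_fam (injM p q C) by move=> l; rewrite -(cE l).2.
have {}eg : exact_at (projM p q C) g by move=> l; rewrite -(cE l).1.
split; first exact: presentation_brick hC bM hf if_ ef sc hg sg eg.
have dN := presentation_dim sg eg.
have dM l : dimz M l = dimz (injs k p) l - dimz (injs k q) l.
  rewrite /dimz; have /eqP <- := if_ l; rewrite (eqmxP (ef l)) mxrank_ker.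
  have /eqP rC := sc l; have := rank_leq_row (injM p q C l).
  by rewrite rC => le_qp; rewrite subzn.
have cox_e : cox (dimz M) (fun l => dimz (projs k q) l - dimz (projs k p) l).
  apply: eq_cox (cox_add (cox_injs_projs Huniq k p)
    (cox_opp (cox_injs_projs Huniq k q))) => l; rewrite ?dM //.
  by rewrite opprK addrC.
have [/forallP fr|] := boolP [forall l, row_free (projM p q C l)].
  left; apply: eq_cox cox_e => l //; rewrite [RHS]/dimz dN.
  have /eqP rC := fr l; have := rank_leq_col (projM p q C l).
  by rewrite rC => le_pq; rewrite subzn.
rewrite negb_forall => /existsP[l0 nfr].
have [/(_ l0)|fu] := presentation_dichotomy hC bM hf if_ ef sc; first by rewrite (negPf nfr).
right; split=> [l|]; first by have /eqP rC := fu l; rewrite dN rC subnn.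
exists (fun l => dimz (projs k q) l - dimz (projs k p) l); split=> // [l|].
  have /eqP rC := fu l; have := rank_leq_row (projM p q C l).
  by rewrite rC subr_le0 lez_nat.
exists l0; have /eqP rC := fu l0; have := rank_leq_row (projM p q C l0).
by rewrite leq_eqVlt [_ == _](negPf nfr) rC /= subr_lt0 ltz_nat.
Qed.

Lemma tau_inv_iter_brick (M N : rep k Q) m :
  brick M -> is_tau_inv_iter m M N -> brick N.
Proof.
move=> bM; elim: m N => [|m IH] N /=; first exact: isom_brick.
by case=> L /IH bL /(tau_inv_brick_dim bL)[].
Qed.

Lemma tau_inv_zero (M N : rep k Q) :
  brick M -> is_tau_inv M N -> (forall l, Defs.dimv M l = 0%N) ->
  forall l, Defs.dimv N l = 0%N.
Proof.
move=> bM /(tau_inv_brick_dim bM)[_ [MN|[]//]] M0 l.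
have c0 : cox (dimz M) (fun _ => 0).
  move=> x; rewrite /out_sum /in_sum [X in _ = X + _]big1 //.
  by rewrite [X in _ = _ + X]big1 => [|a _]; rewrite /dimz M0.
by have := cox_unique Huniq MN c0 l; rewrite /dimz => -[].
Qed.

(* As long as no iterate vanishes, the dimension vectors are the iterates of
   the inverse Coxeter transformation. *)
Lemma tau_inv_iter_dims (M N : rep k Q) m :
    brick M -> is_tau_inv_iter m M N -> (exists l, Defs.dimv N l != 0%N) ->
  exists D : nat -> vert Q -> int,
    [/\ D 0%N =1 dimz M, D m =1 dimz N,
        forall j, (j < m)%N -> cox (D j) (D j.+1) &
        forall j l, 0 <= D j l].
Proof.
move=> bM; elim: m N => [|m IH] N /=.
  move=> MN _; exists (fun _ => dimz M); split=> // l.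
  by rewrite /dimz (isom_dimv l MN).
case=> L ML LN [l Nl]; have bL := tau_inv_iter_brick bM ML.
have [|D [D0 Dm Dcox Dge0]] := IH L ML.
  apply/existsP; apply: contraNT Nl; rewrite negb_exists => /forallP L0.
  apply/eqP/(tau_inv_zero bL LN) => l'; apply/eqP.
  by have := L0 l'; rewrite negbK.
have [_ [cLN|[N0]]] := tau_inv_brick_dim bL LN; last by rewrite N0 eqxx in Nl.
(* Beyond [m] the sequence stays at [dimz N], which keeps it nonnegative everywhere. *)
exists (fun j => if (j <= m)%N then D j else dimz N); split=> //.
- by rewrite ltnn.
- move=> j; rewrite ltnS => le_jm; rewrite le_jm; case: ltnP => [|le_mj].
    exact: Dcox.
  have -> : j = m by apply/eqP; rewrite eqn_leq le_jm.
  exact: eq_cox (fsym Dm) (frefl _) cLN.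
- by move=> j l'; case: ifP.
Qed.

End TauInverse.
(** * Unfolding type D onto type A *)

Section Graded.
Variables (Q : quiver) (pos : vert Q -> int).
Implicit Types (a b : arr Q).

Let slope a := pos (tgt a) - pos (src a).

Hypotheses (slope1 : forall a, slope a = 1 \/ slope a = -1)
  (slope_src : forall a b, tgt a = src b -> slope b = slope a)
  (slope_inj : forall a b, src a = src b -> slope a = slope b ->
     a = b \/ tgt a <> tgt b /\ forall c, src c <> tgt a /\ src c <> tgt b).

Lemma slope_walk i a (s : seq (arr Q)) j :
  walk i (a :: s) j -> pos j - pos i = slope a *+ (size s).+1.
Proof.
elim: s a i => [|b s IH] a i /= /andP[/eqP <-]; first by move/eqP <-.
move=> /[dup] /IH bj /andP[/eqP /esym/slope_src ab _].
by rewrite mulrS -ab -bj ab addrC addrA subrK.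
Qed.

(** Along a walk [pos] moves by a constant step 1 or -1, so closed walks are empty and walks with
    common ends start with the same slope. Different first arrows would then lead to two distinct
    sinks, where the walks must stop. *)
Lemma graded_unique_walks : unique_walks Q.
Proof.
have nz i a s : walk i (a :: s) i -> False.
  move=> /slope_walk/eqP; rewrite subrr eq_sym mulrn_eq0 /=.
  by case: (slope1 a) => ->.
move=> i j; move=> s; elim: s i => [|a s IH] i [|b s'] //.
- by move=> /eqP ->; move/nz.
- by move=> w /eqP ij; move: w; rewrite -ij => /nz.
move=> wa wb; have := slope_walk wa; rewrite (slope_walk wb) => ab.
have /andP[/eqP ai wa'] := wa; have /andP[/eqP bi wb'] := wb.
have slope_ab : slope a = slope b.
  by move: ab; have [->|->] := slope1 a; have [->|->] := slope1 b; rewrite ?mulNrn ?natz; lia.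
case: (slope_inj (etrans ai (esym bi)) slope_ab) => [eq_ab|[tab sink]].
  by rewrite -eq_ab in wb' *; rewrite (IH _ _ wa' wb').
case: s wa' {IH wa ab} => [|c s] /=; last by case/andP=> /eqP/(sink c).1.
case: s' wb' {wb} => [|c s] /=; last by case/andP=> /eqP ? _ _; case: (sink c).2.
by move=> /eqP <- /eqP.
Qed.

End Graded.

(** [out_sum] for the linear quiver on 0, ..., [m] whose arrow [a] is [a -> a.+1] iff [c a].
    Negating [c] turns it into [in_sum]. *)
Definition path_sum (m : nat) (c : nat -> bool) (F : nat -> int) (x : nat) : int :=
  (if (x < m)%N && c x then F x.+1 else 0) +
  (if (0 < x <= m)%N && ~~ c x.-1 then F x.-1 else 0).

Lemma path_sumE (m : nat) (c : nat -> bool) (F : nat -> int) (x : nat) :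
  \sum_(a < m | (if c a then a : nat else a.+1) == x) F (if c a then a.+1 else a) =
  path_sum m c F x.
Proof.
rewrite (bigID (fun a : 'I_m => c a)) /=; congr (_ + _).
  transitivity (\sum_(a < m | a == x :> nat) if c a then F a.+1 else 0).
    rewrite big_mkcond [RHS]big_mkcond /=; apply: eq_bigr => a _.
    by case: (c a); rewrite ?andbT ?andbF ?if_same.
  by rewrite (big_ord1_eq _ (fun a => if c a then F a.+1 else 0)); case: ltnP => //=.
case: x => [|x].
  rewrite big1 //= => a; case: (c a); rewrite ?andbF //.
transitivity (\sum_(a < m | a == x :> nat) if c a then 0 else F a).
  rewrite big_mkcond [RHS]big_mkcond /=; apply: eq_bigr => a _.
  by case: (c a); rewrite ?andbT ?andbF ?if_same //= eqSS.
rewrite (big_ord1_eq _ (fun a => if c a then 0 else F a)) /=.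
by case: ltnP => //= _; case: (c x).
Qed.

(** The reflection sends arrow [a] to arrow [m - a.+1] with its ends swapped, so the condition on
    [c] makes it an automorphism of the quiver. *)
Lemma path_sum_rev (m : nat) (c : nat -> bool) (F : nat -> int) (x : nat) :
    (forall a, (a < m)%N -> c (m - a.+1)%N = ~~ c a) -> (x <= m)%N ->
  path_sum m c (fun i => F (m - i)%N) x = path_sum m c F (m - x)%N.
Proof.
move=> cN xm; rewrite /path_sum addrC; congr (_ + _).
  case: x xm => [|x] xm /=; first by rewrite subn0 ltnn.
  by rewrite xm -cN // subnSK // leq_subr.
rewrite subn_gt0 leq_subr andbT -subnS; case: ltnP => //= xm'.
by rewrite cN // negbK.
Qed.

Ltac decide_nat :=
  repeat match goal with
  | |- context [leq ?a ?b] =>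
      (have -> : leq a b = true by lia) || (have -> : leq a b = false by lia)
  | |- context [@eq_op _ ?a ?b] =>
      (have -> : (a == b :> nat) = true by lia) || (have -> : (a == b :> nat) = false by lia)
  end.

Section Folding.
Variables (n : nat) (hn : (4 <= n)%N).
Implicit Types (c : nat -> bool) (F : nat -> int).

(* Vertices and arrows are counted from 0 here, so that in type A the middle
   vertex is [n - 2], and in type D the vertices [n - 2] and [n - 1] are both
   joined to [n - 3]. *)

Definition fork_sum c F (x : nat) : int :=
  path_sum (n - 2) c F x +
  (if (if c (n - 2)%N then (n - 3)%N else (n - 1)%N) == x
   then F (if c (n - 2)%N then (n - 1)%N else (n - 3)%N) else 0).

Definition unfold_arr c (a : nat) : bool :=
  if (a < n - 2)%N then c a else ~~ c (2 * n - 5 - a)%N.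

Definition theta F (i : nat) : int :=
  if (i < n - 2)%N then F i
  else if i == (n - 2)%N then F (n - 2)%N + F (n - 1)%N else F (2 * n - 4 - i)%N.

Lemma theta_rev F (i : nat) : (i <= 2 * n - 4)%N -> theta F (2 * n - 4 - i)%N = theta F i.
Proof.
move=> le_i; rewrite /theta; case: (ltngtP i (n - 2)%N) => [lt_i|gt_i|->].
- by rewrite ifF; [rewrite ifF; [congr F|]|]; lia.
- by rewrite ifT //; lia.
- by rewrite ifF; [rewrite ifT|]; lia.
Qed.

Lemma unfold_arr_rev c (a : nat) : (a < 2 * n - 4)%N ->
  unfold_arr c (2 * n - 4 - a.+1)%N = ~~ unfold_arr c a.
Proof.
move=> lt_a; rewrite /unfold_arr; case: (ltnP a (n - 2)) => ha.
  by rewrite ifF; [congr (~~ c _)|]; lia.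
by rewrite ifT ?negbK; [congr c|]; lia.
Qed.

(** By reflection [x <= n - 2] suffices. At [n - 3] the middle value is the sum over both fork ends;
    at the middle vertex, the two neighbours carry equal values, one for each fork end. Both use
    that the fork arrows are oriented alike. *)
Lemma path_sum_theta c F (x : nat) : c (n - 3)%N = c (n - 2)%N -> (x <= 2 * n - 4)%N ->
  path_sum (2 * n - 4) (unfold_arr c) (theta F) x = theta (fork_sum c F) x.
Proof.
move=> hc; wlog le_x : x / (x <= n - 2)%N => [IH|_].
  move=> hx; have [/IH->//|lt_x] := leqP x (n - 2).
  rewrite -theta_rev // -IH ?leq_subr //; last by lia.
  rewrite -path_sum_rev ?leq_subr // => [|a]; last exact: unfold_arr_rev.
  rewrite /path_sum; congr (_ + _).
    by case: ifP => // /andP[? _]; rewrite theta_rev.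
  by case: ifP => // /andP[? _]; rewrite theta_rev //; lia.
rewrite /path_sum /theta /fork_sum /path_sum /unfold_arr.
have [lt_x|ge_x] := ltnP x (n - 3).
  by case: x lt_x le_x => [|x] lt_x le_x; case: (c (n - 2)%N); decide_nat; rewrite /= ?addr0.
have [->|x_mid] := eqVneq x (n - 3)%N.
  have -> : (n - 3).+1 = (n - 2)%N by lia.
  by rewrite hc; case: (c (n - 2)%N); decide_nat; rewrite /= ?addr0 ?add0r // addrAC.
have -> : x = (n - 2)%N by lia.
have -> : (n - 2).-1 = (n - 3)%N by lia.
have -> : (2 * n - 5 - (n - 2))%N = (n - 3)%N by lia.
have -> : (2 * n - 4 - (n - 2).+1)%N = (n - 3)%N by lia.
by rewrite hc; case: (c (n - 2)%N); decide_nat; rewrite /= ?addr0 ?add0r.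
Qed.
End Folding.

(** * Neighbour sums, mirror symmetry and folding for [QA] and [QD] *)

Lemma eq_path_sum (m : nat) (c : nat -> bool) (F G : nat -> int) (x : nat) :
    (forall i, (i <= m)%N -> F i = G i) -> (x <= m)%N ->
  path_sum m c F x = path_sum m c G x.
Proof.
move=> FG le_x; rewrite /path_sum; congr (_ + _); case: ifP => // /andP[x_m _].
  exact: FG.
by apply: FG; rewrite (leq_trans (leq_pred x)).
Qed.

Lemma vxE (m i : nat) : (i <= m.+1)%N -> vx m i = i.-1 :> nat.
Proof. by move=> le_i; rewrite inordK //; lia. Qed.

Definition ext (m : nat) (f : 'I_m.+1 -> int) (i : nat) : int := f (inord i).

Lemma extE (m : nat) (f : 'I_m.+1 -> int) (v : 'I_m.+1) : ext f v = f v.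
Proof. by rewrite /ext inord_val. Qed.

Section Quivers.
Variables (n : nat) (hn : (4 <= n)%N) (o : nat -> bool).
Notation A := (QA n o).
Notation D := (QD n o).

Let c (a : nat) : bool := o a.+1.

Lemma oA_unfold (a : nat) : (a < 2 * n - 4)%N -> oA n o a.+1 = unfold_arr n c a.
Proof.
by move=> lt_a; rewrite /oA /unfold_arr /c; case: ifP => // ?; congr (~~ o _); lia.
Qed.

Lemma srcA (a : arr A) : src a = (if unfold_arr n c a then a : nat else a.+1) :> nat.
Proof.
have := ltn_ord a; rewrite -oA_unfold //= /num => ?.
by case: ifP => _; rewrite vxE //; lia.
Qed.

Lemma tgtA (a : arr A) : tgt a = (if unfold_arr n c a then a.+1 else a : nat) :> nat.
Proof.
have := ltn_ord a; rewrite -oA_unfold //= /num => ?.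
by case: ifP => _; rewrite vxE //; lia.
Qed.

(** Counting from 0, [minn b (n - 3)] is the lower end of arrow [b]: the last arrow, [n - 2], is
    attached to [n - 3] like the one before it. *)
Lemma srcD (b : arr D) : src b = (if c b then minn b (n - 3) else b.+1) :> nat.
Proof.
have := ltn_ord b; rewrite /= /num /c /beta_low => ?.
by case: (o _); [case: ifP => ?|]; rewrite vxE //; lia.
Qed.

Lemma tgtD (b : arr D) : tgt b = (if c b then b.+1 else minn b (n - 3)) :> nat.
Proof.
have := ltn_ord b; rewrite /= /num /c /beta_low => ?.
by case: (o _); [|case: ifP => ?]; rewrite vxE //; lia.
Qed.

Lemma unique_walksA : unique_walks A.
Proof.
apply: (@graded_unique_walks A (fun v => (v : nat)%:Z)) => [a|a b ab|a b ab].
- by rewrite srcA tgtA; case: ifP; [left|right]; lia.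
- have : tgt a = src b :> nat by rewrite ab.
  rewrite !srcA !tgtA; case: ifP => ca; case: ifP => cb; try lia.
    by case=> eq_ab; rewrite -eq_ab ca in cb.
  by move=> eq_ab; rewrite -eq_ab ca in cb.
- have : src a = src b :> nat by rewrite ab.
  rewrite !srcA !tgtA => ab' sl; left; apply: val_inj; move: ab' sl.
  by case: ifP => ca; case: ifP => cb /=; lia.
Qed.

Lemma out_sumA (f : vert A -> int) (v : vert A) :
  out_sum f v = path_sum (2 * n - 4) (unfold_arr n c) (ext f) v.
Proof.
rewrite -path_sumE; apply: eq_big => [a|a _]; first by rewrite -srcA.
by rewrite -tgtA extE.
Qed.

Lemma unfold_arrN (e : nat -> bool) a : unfold_arr n (fun i => ~~ e i) a = ~~ unfold_arr n e a.
Proof. by rewrite /unfold_arr; case: ifP. Qed.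

Lemma in_sumA (f : vert A -> int) (v : vert A) :
  in_sum f v = path_sum (2 * n - 4) (unfold_arr n (fun a => ~~ c a)) (ext f) v.
Proof.
rewrite -path_sumE; apply: eq_big => [a|a _].
  by rewrite unfold_arrN if_neg -tgtA.
by rewrite unfold_arrN if_neg -srcA extE.
Qed.

Lemma fork_sumE (e : nat -> bool) (F : nat -> int) (x : nat) :
  \sum_(b < n - 1 | (if e b then minn b (n - 3) else b.+1) == x)
     F (if e b then b.+1 else minn b (n - 3)) = fork_sum n e F x.
Proof.
have -> : (n - 1 = (n - 2).+1)%N by lia.
rewrite big_mkcond big_ord_recr /= /fork_sum -path_sumE; congr (_ + _).
  rewrite [RHS]big_mkcond; apply: eq_bigr => b _ /=.
  by have -> : minn b (n - 3) = b by have /= := ltn_ord b; lia.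
have -> : minn (n - 2) (n - 3) = (n - 3)%N by lia.
by have -> : (n - 2).+1 = (n - 1)%N by lia.
Qed.

Lemma out_sumD (f : vert D -> int) (v : vert D) :
  out_sum f v = fork_sum n c (ext f) v.
Proof.
rewrite -fork_sumE; apply: eq_big => [b|b _]; first by rewrite -srcD.
by rewrite -tgtD extE.
Qed.

Lemma in_sumD (f : vert D -> int) (v : vert D) :
  in_sum f v = fork_sum n (fun a => ~~ c a) (ext f) v.
Proof.
rewrite -fork_sumE; apply: eq_big => [b|b _]; first by rewrite if_neg -tgtD.
by rewrite if_neg -srcD extE.
Qed.

(* A vertex of the arm of D is copied to itself and to its mirror image, and
   the two ends of the fork are added up in the middle. *)
Definition Theta (f : vert D -> int) (v : vert A) : int := theta n (ext f) v.

Lemma eq_theta (F G : nat -> int) (i : nat) :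
  (forall j, (j < n)%N -> F j = G j) -> (i <= 2 * n - 4)%N -> theta n F i = theta n G i.
Proof.
move=> FG le_i; rewrite /theta; case: ifP => [?|?]; first by apply: FG; lia.
case: ifP => [_|?]; last by apply: FG; lia.
by congr (_ + _); apply: FG; lia.
Qed.

Lemma ltnA (v : vert A) : (v <= 2 * n - 4)%N.
Proof. by have := ltn_ord v. Qed.

Lemma Theta_sum (e : nat -> bool) (f g : vert D -> int) (v : vert A) :
    e (n - 3)%N = e (n - 2)%N -> (forall w, g w = fork_sum n e (ext f) w) ->
  path_sum (2 * n - 4) (unfold_arr n e) (ext (Theta f)) v = Theta g v.
Proof.
move=> he gE; rewrite (@eq_path_sum _ _ _ (theta n (ext f))) ?ltnA // => [|i le_i].
  rewrite path_sum_theta ?ltnA //; apply: eq_theta (ltnA v) => j lt_j.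
  by rewrite /ext gE inordK //; lia.
by rewrite /ext /Theta inordK //; lia.
Qed.

Lemma ThetaD f g v : Theta (fun w => f w + g w) v = Theta f v + Theta g v.
Proof. by rewrite /Theta /theta /ext; do 2?case: ifP => // _; rewrite addrACA. Qed.

Lemma eq_Theta f g : f =1 g -> Theta f =1 Theta g.
Proof. by move=> fg v; apply: eq_theta (ltnA v) => j _; rewrite /ext fg. Qed.

Definition mirror (f : vert A -> int) (v : vert A) : int := f (rev_ord v).

Lemma mirror_sum (e : nat -> bool) (f g : vert A -> int) (v : vert A) :
    (forall w, g w = path_sum (2 * n - 4) (unfold_arr n e) (ext f) w) ->
  path_sum (2 * n - 4) (unfold_arr n e) (ext (mirror f)) v = mirror g v.
Proof.
move=> gE; rewrite (@eq_path_sum _ _ _ (fun i => ext f (2 * n - 4 - i)%N)) ?ltnA // => [|i le_i].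
  rewrite path_sum_rev ?ltnA // => [|a]; last exact: unfold_arr_rev.
  by rewrite /mirror gE /= subSS.
rewrite /ext /mirror; congr f; apply: val_inj; rewrite /= !inordK ?subSS //; lia.
Qed.

Lemma out_sum_mirror f : out_sum (mirror f) =1 mirror (out_sum f).
Proof. by move=> v; rewrite out_sumA; apply: mirror_sum; apply: out_sumA. Qed.

Lemma in_sum_mirror f : in_sum (mirror f) =1 mirror (in_sum f).
Proof. by move=> v; rewrite in_sumA; apply: mirror_sum; apply: in_sumA. Qed.

Lemma cox_mirror d e : cox d e -> cox (mirror d) (mirror e).
Proof. by move=> de v; rewrite out_sum_mirror in_sum_mirror; apply: de. Qed.

Definition delta (f : vert D -> int) : int := ext f (n - 2) - ext f (n - 1).

(** Both fork ends have [n - 3] as their only neighbour, through arrows oriented alike. *)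
Lemma fork_sum_delta (e : nat -> bool) (F : nat -> int) :
  e (n - 3)%N = e (n - 2)%N -> fork_sum n e F (n - 2) = fork_sum n e F (n - 1).
Proof.
move=> he; rewrite /fork_sum /path_sum.
have -> : (n - 2).-1 = (n - 3)%N by lia.
rewrite he; case: (e (n - 2)%N); decide_nat; rewrite /= ?addr0 ?add0r //.
Qed.

Hypothesis ho : o (n - 2)%N = o (n - 1)%N.

Lemma c_fork : c (n - 3)%N = c (n - 2)%N.
Proof.
rewrite /c; have -> : (n - 3).+1 = (n - 2)%N by lia.
by have -> : (n - 2).+1 = (n - 1)%N by lia.
Qed.

(** The grading puts both fork ends at height [n - 2], so the last two arrows have equal slope. They
    share a source only when leaving [n - 3], and then they end in distinct sinks. *)
Lemma unique_walksD : unique_walks D.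
Proof.
pose pos (v : vert D) : int := (minn v (n - 2))%:Z.
have c_low (a b : arr D) : minn a (n - 3) = minn b (n - 3) -> c a = c b.
  have := ltn_ord a; have := ltn_ord b; move=> /= ltb lta ab.
  have [->//|ne_ab] := eqVneq (a : nat) b.
  have : (a = n - 3 :> nat /\ b = n - 2 :> nat \/ a = n - 2 :> nat /\ b = n - 3 :> nat)%N by lia.
  by case=> -[-> ->]; rewrite c_fork.
apply: (@graded_unique_walks D pos) => [a|a b ab|a b ab].
- rewrite /pos srcD tgtD; have /= := ltn_ord a.
  by case: ifP; [left|right]; lia.
- have : tgt a = src b :> nat by rewrite ab.
  rewrite /pos !srcD !tgtD; have /= := ltn_ord a; have /= := ltn_ord b.
  case: ifP => ca; case: ifP => cb lta ltb; try lia.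
    by case=> eq_ab; rewrite -eq_ab ca in cb.
  by move=> eq_ab; rewrite (c_low a b) // cb in ca.
- have : src a = src b :> nat by rewrite ab.
  rewrite /pos !srcD !tgtD; have /= := ltn_ord a; have /= := ltn_ord b.
  move=> ltb lta ab' sl.
  have [eq_ab|ne_ab] := eqVneq (a : nat) b; first by left; apply: val_inj.
  right; move: ab' sl; case: ifP => ca; case: ifP => cb; try lia.
  move=> ab' sl; split=> [/(congr1 val)|d].
    by rewrite /= -/(tgt a) -/(tgt b) !tgtD ca cb => -[] /eqP; rewrite (negPf ne_ab).
  split=> /(congr1 (fun v : vert D => v : nat)); rewrite srcD tgtD ?ca ?cb.
    case: ifP => cd; first by lia.
    by case=> eq_da; rewrite eq_da ca in cd.
  case: ifP => cd; first by lia.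
  by case=> eq_db; rewrite eq_db cb in cd.
Qed.

Lemma out_sum_Theta f : out_sum (Theta f) =1 Theta (out_sum f).
Proof. by move=> v; rewrite out_sumA; apply: Theta_sum c_fork (out_sumD f). Qed.

Lemma in_sum_Theta f : in_sum (Theta f) =1 Theta (in_sum f).
Proof.
move=> v; rewrite in_sumA; apply: Theta_sum (in_sumD f).
by rewrite c_fork.
Qed.

Lemma cox_Theta d e : cox d e -> cox (Theta d) (Theta e).
Proof.
by move=> de v; rewrite -ThetaD (eq_Theta de) ThetaD out_sum_Theta in_sum_Theta.
Qed.

Lemma delta_out_sum f : delta (out_sum f) = 0.
Proof.
rewrite /delta /ext !out_sumD !inordK; try lia.
by rewrite fork_sum_delta ?subrr // c_fork.
Qed.

Lemma delta_in_sum f : delta (in_sum f) = 0.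
Proof.
rewrite /delta /ext !in_sumD !inordK; try lia.
by rewrite fork_sum_delta ?subrr // c_fork.
Qed.

(** The neighbour sums agree at the two fork ends, so [delta] kills the right-hand side of [cox]. *)
Lemma delta_cox d e : cox d e -> delta e = - delta d.
Proof.
move=> de; apply/eqP; rewrite -addr_eq0; apply/eqP.
transitivity (delta (fun v => e v + d v)); first by rewrite /delta /ext; lia.
transitivity (delta (out_sum e) + delta (in_sum d)).
  by rewrite /delta /ext !de; lia.
by rewrite delta_out_sum delta_in_sum.
Qed.

End Quivers.

(** * Dimension vectors of the iterates, read off from type A *)

Section Unfolding.
Variables (n : nat) (hn : (4 <= n)%N) (o : nat -> bool).
Hypothesis ho : o (n - 2)%N = o (n - 1)%N.
Variable k : fieldType.
Notation A := (QA n o).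
Notation D := (QD n o).

Let uA : unique_walks A := @unique_walksA n hn o.
Let uD : unique_walks D := @unique_walksD n hn o ho.

(** As [Theta] commutes with [out_sum], both sides solve the same triangular recursion with
    inhomogeneous term [f]. *)
Lemma Theta_conn (l : vert D) (f g : vert A -> int) :
    (forall v, Theta (fun w : vert D => (w == l)%:Z) v = f v) ->
    (forall v, g v = f v + out_sum g v) ->
  Theta (fun w => (conn w l)%:Z) =1 g.
Proof.
move=> lf gf; apply: (out_eq_unique uA (c := f)) => // v.
rewrite out_sum_Theta // -lf -ThetaD; apply: eq_Theta => // w.
exact: conn_out_sum uD l w.
Qed.

Lemma Theta_conn_arm (l : vert D) (i : vert A) : i = l :> nat -> (l < n - 2)%N ->
  Theta (fun w => (conn w l)%:Z) =1
  (fun v => (conn v i)%:Z + mirror (fun v => (conn v i)%:Z) v).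
Proof.
move=> il lt_l; pose d (v : vert A) : int := (v == i)%:Z.
apply: (Theta_conn (f := fun v => d v + mirror d v)) => v; rewrite /d.
  have /= := ltn_ord v => lt_v; rewrite /Theta /theta /ext /mirror -!val_eqE /= il.
  case: ifP => [lt_v'|ge_v]; first by rewrite inordK; lia.
  by case: ifP => [v_mid|nv_mid]; rewrite !inordK; lia.
rewrite {1}/mirror !(conn_out_sum uA) -/(mirror _ v).
rewrite addrACA; congr (_ + _).
transitivity (out_sum (fun v => (conn v i)%:Z) v + out_sum (mirror (fun v => (conn v i)%:Z)) v).
  by rewrite out_sum_mirror.
by rewrite /out_sum -big_split.
Qed.

Lemma Theta_conn_fork (l : vert D) (i : vert A) : i = (n - 2)%N :> nat -> (n - 2 <= l)%N ->
  Theta (fun w => (conn w l)%:Z) =1 (fun v => (conn v i)%:Z).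
Proof.
move=> il ge_l; apply: (Theta_conn (f := fun v => (v == i)%:Z)) => v.
  have /= := ltn_ord v => lt_v; have /= := ltn_ord l => lt_l.
  rewrite /Theta /theta /ext -!val_eqE /= il.
  case: ifP => [lt_v'|ge_v]; first by rewrite inordK; lia.
  by case: ifP => [v_mid|nv_mid]; rewrite !inordK; lia.
exact: conn_out_sum uA i v.
Qed.

Lemma dimz_proj (Q : quiver) (Huniq : unique_walks Q) (i : vert Q) :
  dimz (proj k i) =1 (fun v => (conn v i)%:Z).
Proof. by move=> v; rewrite dimz_projs // big_ord1. Qed.

Lemma delta_proj (l : vert D) :
  delta (dimz (proj k l)) = (l == n - 2 :> nat)%N%:Z - (l == n - 1 :> nat)%N%:Z.
Proof.
have lE := dimz_proj uD l.
have eE v : dimz (proj k l) v = (v == l)%:Z + out_sum (dimz (proj k l)) v.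
  rewrite lE (conn_out_sum uD); congr (_ + _).
  by apply: eq_bigr => a _; rewrite lE.
have := delta_out_sum hn ho (dimz (proj k l)); rewrite /delta /ext.
rewrite (eE (inord (n - 2))) (eE (inord (n - 1))) -!val_eqE /= !inordK; lia.
Qed.

(* An iterate on the D side cannot vanish before the one on the A side: if an
   injective module came up, the image under [Theta] of the negative vector
   [- dim P] would be nonnegative. *)
Lemma Theta_tau_inv_iter (l : vert D) (d : nat -> vert A -> int) m (X : rep k D) :
    (forall j, (j < m)%N -> cox (d j) (d j.+1)) -> (forall j v, 0 <= d j v) ->
    Theta (dimz (proj k l)) =1 d 0%N -> is_tau_inv_iter m (proj k l) X ->
  Theta (dimz X) =1 d m /\ delta (dimz X) = (-1) ^+ m * delta (dimz (proj k l)).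
Proof.
move=> dcox d0 Pd; elim: m X dcox => [|m IH] X dcox /=.
  move=> PX; have PXE : dimz X =1 dimz (proj k l).
    by move=> w; rewrite /dimz (isom_dimv w PX).
  by rewrite expr0 mul1r /delta /ext !PXE; split=> // v; rewrite (eq_Theta hn PXE).
case=> L PL LX; have bL := tau_inv_iter_brick uD (@brick_projs k _ uD l) PL.
have [|LE Ldelta] := IH L _ PL; first by move=> j jm; apply/dcox/ltnW.
have step e : cox (dimz L) e -> Theta e =1 d m.+1.
  move=> Le; apply: (cox_unique uA (d := d m)); last exact: dcox.
  exact: eq_cox LE (frefl _) (cox_Theta hn ho Le).
have [_ [LcX|[_ [e [Le e_le0 [w ew]]]]]] := tau_inv_brick_dim uD bL LX.
  by split; [apply: step | rewrite (delta_cox hn ho LcX) Ldelta exprS mulN1r mulNr].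
have ThE := step e Le; have := ltn_ord w => /= lt_w.
have e_ext j : ext e j <= 0 by apply: e_le0.
have [lt_w2|ge_w2] := ltnP w (n - 2).
  have := d0 m.+1 (inord w); rewrite -ThE /Theta /theta inordK; last by lia.
  by rewrite lt_w2 extE; lia.
(* At the middle vertex [Theta e] adds two nonpositive coordinates, one of them negative. *)
have := d0 m.+1 (inord (n - 2)); rewrite -ThE /Theta /theta inordK; last by lia.
rewrite ltnn eqxx; have := e_ext (n - 2)%N; have := e_ext (n - 1)%N.
move: ew; rewrite -extE.
have [->|->] : w = (n - 2)%N :> nat \/ w = (n - 1)%N :> nat by lia.
  by lia.
by lia.
Qed.

(** A fork coordinate is half of sum plus or minus difference; the division is exact. *)
Lemma Theta_delta_eq (f : vert D -> int) (w : vert D) :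
  f w = if (w < n - 2)%N then Theta f (inord w : vert A)
        else ((Theta f (inord (n - 2) : vert A) +
               (if w == (n - 2)%N :> nat then 1 else -1) * delta f) %/ 2)%Z.
Proof.
have := ltn_ord w => /= lt_w; rewrite /Theta /theta.
case: ifP => [lt_w2|ge_w2]; first by rewrite inordK ?lt_w2 ?extE //; lia.
rewrite inordK ?ltnn ?eqxx /delta; last by lia.
have [w_mid|w_end] := eqVneq (w : nat) (n - 2)%N.
  by rewrite -w_mid extE mul1r; lia.
have w_last : w = (n - 1)%N :> nat by lia.
have ew : ext f (n - 1)%N = f w by rewrite -(extE f w) w_last.
by rewrite ew; lia.
Qed.

Lemma sum_dim_simpleE (a b : int) (w : vert D) :
  sum_dim_simple n o k a b w = (a <= (num w)%:Z <= b).
Proof.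
rewrite /sum_dim_simple sum_ffunE big_mkcond (bigD1 w) //= big1 => [|v /negPf vw].
  by rewrite addr0 /dim_vec ffunE /= eqxx; case: ifP.
by case: ifP => // _; rewrite /dim_vec ffunE /= eq_sym vw.
Qed.

(** Counting vertices from 0, the support [a + 1], ..., [b] becomes [a <= v < b]. *)
Lemma interval_tau_dims (i : vert A) m (a b : nat) : (a < b <= 2 * n - 3)%N ->
    is_tau_inv_iter m (proj k i) (Defs.interval n o k a b) ->
  exists d : nat -> vert A -> int,
    [/\ d 0%N =1 (fun v => (conn v i)%:Z), d m =1 (fun v => (a <= v < b)%N%:Z),
        forall j, (j < m)%N -> cox (d j) (d j.+1) & forall j v, 0 <= d j v].
Proof.
move=> ab PI.
have [|d [d0 dm dcox dge0]] := tau_inv_iter_dims uA (@brick_projs k _ uA i) PI.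
  by exists (inord a); rewrite /= /num inordK; lia.
by exists d; split=> // v; rewrite d0 dimz_proj.
Qed.

(** The projective at [i] has [delta = 0], so the fork coordinates agree. Each is half of the middle
    value, to which the interval and its mirror image contribute equally. *)
Lemma segment_dims (m i a b : nat) (X : rep k D) :
    (1 <= i <= n - 2)%N -> (a < b <= 2 * n - 3)%N ->
    is_tau_inv_iter m (proj k (vx _ i : vert A)) (Defs.interval n o k a b) ->
    is_tau_inv_iter m (proj k (vx _ i : vert D)) X ->
  forall w : vert D, Defs.dimv X w =
    if (w < n - 2)%N then ((a <= w < b) + (a <= 2 * n - 4 - w < b))%N
    else (a <= n - 2 < b)%N : nat.
Proof.
move=> hi ab PI PX w.
have [d [d0 dm dcox dge0]] := interval_tau_dims ab PI.
pose d' j v := d j v + mirror (d j) v.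
have [|||XE Xdelta] := @Theta_tau_inv_iter (vx _ i) d' m X _ _ _ PX.
- by move=> j jm; apply: cox_add (dcox j jm) (cox_mirror hn (dcox j jm)).
- by move=> j v; rewrite addr_ge0 // dge0.
- move=> v; rewrite (eq_Theta hn (dimz_proj uD _)) (@Theta_conn_arm _ (vx _ i)).
  + by rewrite /d' /mirror !d0.
  + by rewrite !vxE //; lia.
  + by rewrite vxE; lia.
have {}Xdelta : delta (dimz X) = 0.
  by rewrite Xdelta delta_proj !vxE; try lia; rewrite !ifF ?mulr0 //; lia.
have := ltn_ord w => /= lt_w.
apply/eqP; rewrite -eqz_nat -[(Defs.dimv X w)%:Z]/(dimz X w) Theta_delta_eq Xdelta !XE.
rewrite /d' /mirror !dm /= !inordK; try lia.
by case: ifP => _; apply/eqP; lia.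
Qed.

(** The fork coordinates have sum 1 and difference 1 or -1, so exactly one of them is 1; [j] and the
    parity of [m] decide which. *)
Lemma diameter_dims (m j a b : nat) (X : rep k D) :
    (n - 1 <= j <= n)%N -> (a <= n - 2 < b)%N -> (b <= 2 * n - 3)%N ->
    is_tau_inv_iter m (proj k (vx _ (n - 1) : vert A)) (Defs.interval n o k a b) ->
    is_tau_inv_iter m (proj k (vx _ j : vert D)) X ->
  forall w : vert D, Defs.dimv X w =
    if (w < n - 2)%N then (a <= w < b)%N : nat
    else ((w == n - 2 :> nat)%N == ((j == n - 1)%N (+) odd m)) : nat.
Proof.
move=> hj ab hb PI PX w.
have [|d [d0 dm dcox dge0]] := interval_tau_dims _ PI; first by lia.
have [|XE Xdelta] := @Theta_tau_inv_iter (vx _ j) d m X dcox dge0 _ PX.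
  move=> v; rewrite (eq_Theta hn (dimz_proj uD _)) (@Theta_conn_fork _ (vx _ (n - 1))).
  + by rewrite d0.
  + by rewrite vxE; lia.
  + by rewrite vxE; lia.
have := ltn_ord w => /= lt_w.
apply/eqP; rewrite -eqz_nat -[(Defs.dimv X w)%:Z]/(dimz X w) Theta_delta_eq Xdelta !XE.
rewrite -signr_odd !dm delta_proj !vxE /= ?inordK; try lia.
case: ifP => _; first by lia.
by case: (odd m); case: (w == _ :> nat); rewrite ?expr0 ?expr1; lia.
Qed.

End Unfolding.

(** * Index arithmetic of the polygon, and the dimension formulas *)

Lemma prime_idx_neg (n : nat) (h : int) : h < 0 -> 1 - n%:Z <= h ->
  (prime_idx n h)%:Z = h + n%:Z - 1.
Proof. by move=> h0 hn; rewrite /prime_idx h0; lia. Qed.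

Lemma prime_idx_pos (n : nat) (h : int) : 0 < h -> (1 <= n)%N ->
  (prime_idx n h)%:Z = h + n%:Z - 2.
Proof. by move=> h0; rewrite /prime_idx ltNge ltW //=; lia. Qed.

Lemma prime_idx_opp (n : nat) (h : int) : h != 0 -> 1 - n%:Z <= h <= n%:Z - 1 ->
  prime_idx n (- h) = (2 * n - 3 - prime_idx n h)%N.
Proof.
move=> h0 hh; case: (ltrgtP h 0) h0 => // h0 _.
  have e1 : (prime_idx n (- h))%:Z = - h + n%:Z - 2 by apply: prime_idx_pos; lia.
  have e2 : (prime_idx n h)%:Z = h + n%:Z - 1 by apply: prime_idx_neg; lia.
  by lia.
have e1 : (prime_idx n (- h))%:Z = - h + n%:Z - 1 by apply: prime_idx_neg; lia.
have e2 : (prime_idx n h)%:Z = h + n%:Z - 2 by apply: prime_idx_pos; lia.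
by lia.
Qed.

Lemma prime_idx_lt (n : nat) (s t : int) :
    1 - n%:Z <= s -> s < t -> t <= n%:Z - 1 -> s != 0 -> t != 0 -> s != - t ->
  (prime_idx n s < prime_idx n t <= 2 * n - 3)%N.
Proof.
move=> hs st ht s0 t0 nst; case: (ltrgtP t 0) t0 => // t0 _.
  have e1 : (prime_idx n t)%:Z = t + n%:Z - 1 by apply: prime_idx_neg; lia.
  have e2 : (prime_idx n s)%:Z = s + n%:Z - 1 by apply: prime_idx_neg; lia.
  by lia.
have e1 : (prime_idx n t)%:Z = t + n%:Z - 2 by apply: prime_idx_pos; lia.
case: (ltrgtP s 0) s0 => // s0 _.
  have e2 : (prime_idx n s)%:Z = s + n%:Z - 1 by apply: prime_idx_neg; lia.
  by lia.
have e2 : (prime_idx n s)%:Z = s + n%:Z - 2 by apply: prime_idx_pos; lia.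
by lia.
Qed.

Theorem theorem4p16 (R : realType) (k : closedFieldType)
    (hk : 2%N \notin [pchar k]) (n : nat) (hn : (4 <= n)%N)
    (o : nat -> bool) (ho : o (n - 2)%N = o (n - 1)%N) :
  (forall (t : int) (l : bool) (X : rep k (QD n o)),
      Omega n (Diam t l) -> F_D R (Diam t l) X ->
      dim_vec X =
        if l then sum_dim_simple n o k (n%:Z - t) (n%:Z - 1)
        else sum_dim_simple n o k (n%:Z - t) (n%:Z - 2)
             + dim_vec (simple k (vx _ n : vert (QD n o)))) /\
  (forall (s t : int) (X : rep k (QD n o)),
      Omega n (Seg s t) -> F_D R (Seg s t) X ->
      [/\ t < 0 ->
            dim_vec X = sum_dim_simple n o k (n%:Z + s) (n%:Z + t - 1),
          s < 0 -> 0 < t ->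
            dim_vec X = sum_dim_simple n o k (n%:Z + s) n%:Z
                        + sum_dim_simple n o k (n%:Z - t) (n%:Z - 2)
        & 0 < s ->
            dim_vec X = sum_dim_simple n o k (n%:Z - t) (n%:Z - s - 1)]).
Proof.
split=> [t l X /= ht [m [_ [PI PX]]]|s t X /= hst [s' [t' [m [i [[eq_st _ _ hi] [PI PX]]]]]]].
  have pt : (prime_idx n t)%:Z = t + n%:Z - 2 by apply: prime_idx_pos; lia.
  have pnt : (prime_idx n (- t))%:Z = - t + n%:Z - 1 by apply: prime_idx_neg; lia.
  have dX := diameter_dims hn ho _ _ _ PI PX.
  apply/ffunP=> w; have /= lt_w := ltn_ord w; rewrite ffunE dX {dX PI PX}; try lia; last first.
    by case: (l); case: (odd m); lia.
  move: pt pnt; move: (prime_idx n t) (prime_idx n (- t)) => a b pa pb.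
  (* The parity rule in [F_D] cancels the sign [(-1)^m], so the tag alone selects the fork end. *)
  case: l; rewrite ?ffunE sum_dim_simpleE /num.
    by case: (odd m); case: ifP => ?; lia.
  rewrite /= -val_eqE /= vxE; last by lia.
  by case: (odd m); case: ifP => ?; lia.
have [/andP[hs0 hs1] /andP[ht0 ht1] s0 t0 st] : [/\ 1 - n%:Z <= s <= n%:Z - 1,
  1 - n%:Z <= t <= n%:Z - 1, s != 0, t != 0 & s < t].
  by split; lia.
have ab : (prime_idx n s < prime_idx n t <= 2 * n - 3)%N.
  by apply: prime_idx_lt; lia.
have dX w : Defs.dimv X w =
    if (w < n - 2)%N then ((prime_idx n s <= w < prime_idx n t) +
                           (prime_idx n s <= 2 * n - 4 - w < prime_idx n t))%N
    else (prime_idx n s <= n - 2 < prime_idx n t)%N : nat.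
  have /= lt_w := ltn_ord w.
  case: eq_st => [[? ?]|[s1 [t1 [[? ?] [? ?]]]]]; subst s' t'; last subst s1 t1.
    by rewrite (segment_dims hn ho hi _ PI PX).
  (* For the representative [(-t, -s)] the interval is reflected, which swaps the two summands on
     the arm and fixes the middle vertex. *)
  rewrite (prime_idx_opp (h := t)) in PI; try lia.
  rewrite (prime_idx_opp (h := s)) in PI; try lia.
  move: ab PI; move: (prime_idx n s) (prime_idx n t) => a b ab PI.
  rewrite (segment_dims hn ho hi _ PI PX) {PI PX hi hst}; last by lia.
  have flip v : (v <= 2 * n - 4)%N ->
      (2 * n - 3 - b <= v < 2 * n - 3 - a)%N = (a <= 2 * n - 4 - v < b)%N by lia.
  by rewrite !flip ?subKn 1?addnC; try lia; have -> : (2 * n - 4 - (n - 2) = n - 2)%N by lia.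
(* The interval lies before the middle vertex, contains it, or lies after it. On the arm, only the
   interval counts in the first case, only its mirror image in the last, and both in between, where
   the fork ends are covered too. *)
clear PI PX eq_st hi hst; split=> [t_lt0|s_lt0 t_gt0|s_gt0]; apply/ffunP=> w;
  have /= lt_w := ltn_ord w; rewrite !ffunE dX !sum_dim_simpleE /num {dX}; move: ab.
- have := prime_idx_neg t_lt0 ht0.
  have : (prime_idx n s)%:Z = s + n%:Z - 1 by apply: prime_idx_neg; lia.
  by move: (prime_idx n s) (prime_idx n t) => a b ea eb ab; case: ifP => ?; lia.
- have := prime_idx_neg s_lt0 hs0.
  have : (prime_idx n t)%:Z = t + n%:Z - 2 by apply: prime_idx_pos; lia.
  by move: (prime_idx n s) (prime_idx n t) => a b eb ea ab; case: ifP => ?; lia.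
- have : (prime_idx n s)%:Z = s + n%:Z - 2 by apply: prime_idx_pos; lia.
  have : (prime_idx n t)%:Z = t + n%:Z - 2 by apply: prime_idx_pos; lia.
  by move: (prime_idx n s) (prime_idx n t) => a b eb ea ab; case: ifP => ?; lia.
Qed.
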